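(* Let $D\subset\mathbb C$ be open and connected, let $k\mapsto \mathrm A(k)\in\mathbb C^{2N_h\times 2N_h}$ be the boundary-element matrix (see context), assumed holomorphic in $k$ on $D$ and invertible for at least one $k\in D$, let $\mathrm M$ be the (Hermitian positive definite) mass matrix, and let $\phi(k)=\|\mathrm M^{1/2}\mathrm A(k)^{-1}\mathrm M^{1/2}\|_{\mathrm{sp}}$ be the discrete field amplification, defined for all $k\in D$ with $\mathrm A(k)$ invertible. Let $\lambda\in D$ be such that $\mathrm A(\lambda)$ is singular. Let $m=m(\lambda)\in\mathbb N$, $m\ge 1$, be the length of the longest chain of generalized eigenvectors of $\mathrm A$ associated to $\lambda$. Then there exists $\psi_\lambda>0$, depending only on $\mathrm M$ and on the matrix $\mathrm P_{1,m}$ (the coefficient of $(k-\lambda)^{-m}$ in the expansion of $\mathrm A(k)^{-1}$ around $\lambda$), such that $$\phi(k)=\psi_\lambda\,|k-\lambda|^{-m}+\mathcal O\!\left(|k-\lambda|^{1-m}\right)\qquad\text{as }k\to\lambda .$$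
   Context: Boundary-element matrices. Let $\Omega\subset\mathbb R^d$, $d\in\{2,3\}$, be a bounded Lipschitz domain with boundary $\Gamma$ and outward normal $\nu$, and let $n_{\mathrm i}>0$ be constant (interior refraction index). Let $G(\mathbf x;\kappa)=\frac{\mathrm i}{4}H_0(\kappa\|\mathbf x\|)$ if $d=2$ ($H_0$ the Hankel function of the first kind of index 0) and $G(\mathbf x;\kappa)=\frac{1}{4\pi\|\mathbf x\|}e^{\mathrm i\kappa\|\mathbf x\|}$ if $d=3$. Define boundary-integral operators on $\Gamma$ by $\mathcal V(\kappa)\psi=\int_\Gamma G(\cdot-\mathbf y;\kappa)\psi(\mathbf y)\,dS(\mathbf y)$, $\mathcal K(\kappa)\phi=-\int_\Gamma\partial_{\nu(\mathbf y)}G(\cdot-\mathbf y;\kappa)\phi(\mathbf y)\,dS(\mathbf y)$, $\mathcal K(\kappa)^*\phi=-\int_\Gamma\partial_{\nu(\mathbf x)}G(\cdot-\mathbf y;\kappa)\phi(\mathbf y)\,dS(\mathbf y)$ ($\mathbf x\in\Gamma$ being the evaluation point), $\mathcal W(\kappa)\phi=-\int_\Gamma\partial_{\nu(\cdot)}\partial_{\nu(\mathbf y)}G(\cdot-\mathbf y;\kappa)\phi(\mathbf y)\,dS(\mathbf y)$. Let $\{\psi_i\}_{i=1}^{N_h}$ be a basis of a finite-dimensional (boundary-element) subspace $\mathcal X_h\subset L^2(\Gamma)$, and let $(\cdot,\cdot)$ be the $L^2(\Gamma)$ inner product. The $2N_h\times 2N_h$ matrix $\mathrm B(k)$ has the four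 $N_h\times N_h$ blocks with entries, in row $i$ and column $j$, $((\tfrac12\mathcal I-\mathcal K(k))\psi_j,\psi_i)$ (top left), $(\mathcal V(k)\psi_j,\psi_i)$ (top right), $(\mathcal W(k)\psi_j,\psi_i)$ (bottom left), $((\tfrac12\mathcal I+\mathcal K(k)^* )\psi_j,\psi_i)$ (bottom right). The mass matrix $\mathrm M$ is block diagonal with two diagonal blocks equal to $((\psi_j,\psi_i))_{i,j}$. The boundary-element matrix is $\mathrm A(k)=\mathrm M+\mathrm B(k)-\mathrm B(kn_{\mathrm i})$. Standing assumption: $\mathrm A(k)$ depends holomorphically on $k$ and is invertible for at least one $k$. The only properties of $\mathrm A$ and $\mathrm M$ assumed are this one and that $\mathrm M$ is Hermitian positive definite. Notation. $\|\cdot\|_{\mathrm{sp}}$ is the spectral norm (largest singular value), and $\mathrm M^{1/2}$ is the positive definite square root. Chains of generalized eigenvectors. Vectors $v_0,\dots,v_{\ell-1}\in\mathbb C^{2N_h}\setminus\{0\}$ form a length-$\ell$ chain of generalized eigenvectors of $\mathrm A$ associated to $\lambda$ if $\sum_{n=0}^{j}\frac{1}{(j-n)!}\,\mathrm A^{(j-n)}(\lambda)\,v_n=0$ for all $j=0,\dots,\ell-1$, where $\mathrm A^{(r)}$ is the $r$-th derivative in $k$. Expansion of the inverse. By Keldysh's theorem, the maximal chain length $m$ is the order of $\lambda$ as a pole of $\mathrm A(k)^{-1}$, and in a punctured neighborhood of $\lambda$ one has $\mathrm A(k)^{-1}=\sum_{j=1}^m\frac{\mathrm P_{1,j}}{(k-\lambda)^j}+\mathrm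 H(k)$, with constant matrices $\mathrm P_{1,j}$, $\mathrm P_{1,m}\neq0$, and $\mathrm H$ holomorphic near $\lambda$. *)

(* Defs.v *)
From HB Require Import structures.
From mathcomp Require Import all_boot all_order all_algebra.
From mathcomp Require Import all_classical all_reals all_analysis.
From mathcomp Require Import complex.

Set Implicit Arguments.
Unset Strict Implicit.
Unset Printing Implicit Defensive.

Import Order.TTheory GRing.Theory Num.Theory.
Import numFieldNormedType.Exports.

Local Open Scope classical_set_scope.
Local Open Scope sesquilinear_scope.
Local Open Scope ring_scope.
Local Open Scope complex_scope.

(* [R[i]^o] is the complex numbers with the topology given by the modulus, as a
   normed space over itself; [derivable] and [derive1n] at this type are thus
   complex differentiability and iterated complex derivatives. *)
Notation Cplx R := (R[i]^o).

Section Definitions.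
Variable R : realType.
Implicit Types (n m l r : nat) (z : Cplx R).

Definition cabs (z : R[i]) : R := complex.Re `|z|.

Definition mx_derivable n (A : Cplx R -> 'M[R[i]]_n) z : Prop :=
  forall i j, derivable (fun k => A k i j : Cplx R) z 1.

Definition mx_holomorphic n (D : set (Cplx R)) (A : Cplx R -> 'M[R[i]]_n) :=
  forall z, D z -> mx_derivable A z.

Definition mx_derive n r (A : Cplx R -> 'M[R[i]]_n) z : 'M[R[i]]_n :=
  \matrix_(i, j) derive1n r (fun k => A k i j : Cplx R) z.

Definition posdefmx n (M : 'M[R[i]]_n) : Prop :=
  M \is hermsymmx /\
  forall x : 'cV[R[i]]_n, x != 0 -> 0 < (x^t* *m M *m x) 0 0.

Definition is_sqrtmx n (M S : 'M[R[i]]_n) : Prop := posdefmx S /\ S *m S = M.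

Definition sqrtmx n (M : 'M[R[i]]_n) : 'M[R[i]]_n := xget 0 (is_sqrtmx M).

Definition singular_value n (X : 'M[R[i]]_n) (i : 'I_n) : R :=
  Num.sqrt (complex.Re (spectral_diag (X^t* *m X) 0 i)).

Definition spectral_norm n (X : 'M[R[i]]_n) : R :=
  \big[Num.max/0]_(i < n) singular_value X i.

(* Only meaningful when [A k] is invertible. *)
Definition amplification n (M : 'M[R[i]]_n) (A : Cplx R -> 'M[R[i]]_n) z : R :=
  spectral_norm (sqrtmx M *m invmx (A z) *m sqrtmx M).

Definition is_chain n (A : Cplx R -> 'M[R[i]]_n) z l
    (v : 'I_l -> 'cV[R[i]]_n) : Prop :=
  (forall j, v j != 0) /\
  (forall j : 'I_l, \sum_(s < l | (s <= j)%N)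
     ((j - s)`!%:R)^-1 *: (mx_derive (j - s) A z *m v s) = 0).

Definition has_chain n (A : Cplx R -> 'M[R[i]]_n) z l : Prop :=
  exists v : 'I_l -> 'cV[R[i]]_n, is_chain A z v.

Definition longest_chain n (A : Cplx R -> 'M[R[i]]_n) z m : Prop :=
  has_chain A z m /\ forall l, has_chain A z l -> (l <= m)%N.

(* [P j] is the coefficient of [(k - z)^-j]; only [P 1, ..., P m] matter. *)
Definition inverse_expansion n (A : Cplx R -> 'M[R[i]]_n) z m
    (P : nat -> 'M[R[i]]_n) : Prop :=
  exists H : Cplx R -> 'M[R[i]]_n,
    (\forall k \near z, mx_derivable H k) /\
    (\forall k \near z^', A k \in unitmx /\
       invmx (A k) = (\sum_(1 <= j < m.+1) (k - z) ^- j *: P j) + H k).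

End Definitions.

Section SquareRoot.
Variables (R : realType) (n : nat).
Implicit Types (M S T : 'M[R[i]]_n).

Lemma posdef_form (S : 'M[R[i]]_n) (y : 'rV[R[i]]_n) :
  posdefmx S -> y != 0 -> 0 < (y *m S *m y^t* ) 0 0.
Proof.
case=> _ Sp y0.
have -> : y = (y^t* )^t* by rewrite trmxCK.
rewrite (trmxCK (y^t* )); apply: Sp.
apply: contra y0 => /eqP e; rewrite -(trmxCK y) e.
by rewrite trmx0 map_mx0.
Qed.

Lemma is_sqrtmx_exists M : posdefmx M -> exists S, is_sqrtmx M S.
Proof.
move=> Mp; have [Mh _] := Mp.
have /hermitian_normalmx /orthomx_spectralP Me := Mh.
set P := spectralmx M in Me; set d := spectral_diag M in Me.
have PU : P \is unitarymx by exact: spectral_unitarymx.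
have PPt : P *m P^t* = 1%:M by apply/unitarymxP.
have PtP : P^t* *m P = 1%:M by apply/mulmx1C.
rewrite invmx_unitary // in Me.
have dpos i : 0 < d 0 i.
  have r0 : row i P != 0.
    apply/eqP => r0; have := congr1 (fun X : 'M[R[i]]_n => X i i) PPt.
    rewrite !mxE big1 ?eqxx; first by move/eqP; rewrite eq_sym oner_eq0.
    move=> j _; move/rowP: r0 => /(_ j); rewrite !mxE => ->; exact: mul0r.
  have := posdef_form Mp r0.
  rewrite rowE trmx_mul map_mxM [in X in _ *m X *m _]Me !mulmxA.
  rewrite -(mulmxA _ P (P^t* )) PPt mulmx1 -(mulmxA _ P (P^t* )) PPt mulmx1.
  rewrite -rowE.
  have -> : (delta_mx 0 i : 'rV[R[i]]_n)^t* = delta_mx i 0.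
    by rewrite trmx_delta map_delta_mx.
  by rewrite -colE !mxE eqxx mulr1n.
pose e : 'rV[R[i]]_n := map_mx sqrtC d.
have ee : diag_mx e *m diag_mx e = diag_mx d.
  rewrite mulmx_diag; congr diag_mx; apply/rowP => j.
  by rewrite !mxE -expr2 sqrtCK.
have epos i : 0 < e 0 i by rewrite mxE sqrtC_gt0.
exists (P^t* *m diag_mx e *m P); split; last first.
  rewrite -!mulmxA (mulmxA P) PPt mul1mx.
  by rewrite (mulmxA (diag_mx e)) ee mulmxA -Me.
split.
  apply/is_hermitianmxP; rewrite expr0 scale1r.
  rewrite !trmx_mul !map_mxM trmxCK mulmxA; congr (_ *m _ *m _).
  apply/matrixP => i j; rewrite !mxE rmorphMn /= eq_sym.
  case: eqP => [->|_]; last by rewrite !mulr0n.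
  by rewrite !mulr1n [RHS]geC0_conj // sqrtC_ge0 ltW.
move=> x x0; set y := P *m x.
have y0 : y != 0.
  by apply: contra x0 => /eqP e0; rewrite -(mul1mx x) -PtP -mulmxA -/y e0 mulmx0.
have -> : x^t* *m (P^t* *m diag_mx e *m P) *m x = y^t* *m (diag_mx e *m y).
  by rewrite /y trmx_mul map_mxM !mulmxA.
rewrite mxE.
have tge j : 0 <= (y^t* ) 0 j * (diag_mx e *m y) j 0.
  rewrite mul_diag_mx [X in _ * X]mxE mulrCA.
  apply: mulr_ge0; first exact: ltW (epos j).
  by rewrite !mxE mulrC mul_conjC_ge0.
rewrite lt_def sumr_ge0 // andbT; apply: contra y0.
rewrite psumr_eq0 // => /allP h; apply/eqP/colP => j; rewrite [RHS]mxE.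
have := h j (mem_index_enum _).
rewrite /= mul_diag_mx [X in _ * X]mxE mulrCA mulf_eq0 (gt_eqF (epos j)) /=.
by rewrite [(y^t* ) 0 j]mxE [(y^T) 0 j]mxE mulrC mul_conjC_eq0 => /eqP.
Qed.

Lemma is_sqrtmx_uniq M S T : is_sqrtmx M S -> is_sqrtmx M T -> S = T.
Proof.
move=> [Sp SM] [Tp TM].
have [/is_hermitianmxP Sh _] := Sp; have [/is_hermitianmxP Th _] := Tp.
rewrite expr0 scale1r in Sh; rewrite expr0 scale1r in Th.
pose X := S - T.
have XN : X \is normalmx.
  apply/hermitian_normalmx/is_hermitianmxP; rewrite expr0 scale1r.
  by rewrite /X linearB /= map_mxB -Sh -Th.
have Xh : X = X^t* by rewrite /X linearB /= map_mxB -Sh -Th.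
have key : X *m S + T *m X = 0.
  by rewrite /X mulmxBl mulmxBr SM TM addrA subrK subrr.
have /orthomx_spectralP Xe := XN.
set P := spectralmx X in Xe; set d := spectral_diag X in Xe.
have PU : P \is unitarymx by exact: spectral_unitarymx.
have PPt : P *m P^t* = 1%:M by apply/unitarymxP.
rewrite invmx_unitary // in Xe.
have PX : P *m X = diag_mx d *m P by rewrite Xe !mulmxA PPt mul1mx.
have XP : X *m P^t* = P^t* *m diag_mx d by rewrite Xe -!mulmxA PPt mulmx1.
suff d0 : d = 0.
  by apply/eqP; rewrite -subr_eq0 -/X Xe d0 linear0 mulmx0 mul0mx.
apply/rowP => i; rewrite [RHS]mxE.
have r0 : row i P != 0.
  apply/eqP => r0; have := congr1 (fun Y : 'M[R[i]]_n => Y i i) PPt.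
  rewrite !mxE big1 ?eqxx; first by move/eqP; rewrite eq_sym oner_eq0.
  move=> j _; move/rowP: r0 => /(_ j); rewrite !mxE => ->; exact: mul0r.
have hS := posdef_form Sp r0; have hT := posdef_form Tp r0.
have rX : row i P *m X = d 0 i *: row i P.
  by rewrite -row_mul PX row_mul row_diag_mx -scalemxAl -rowE.
have Xr : X *m (row i P)^t* = d 0 i *: (row i P)^t*.
  rewrite rowE trmx_mul map_mxM mulmxA XP -mulmxA.
  have -> : (delta_mx 0 i : 'rV[R[i]]_n)^t* = delta_mx i 0.
    by rewrite trmx_delta map_delta_mx.
  rewrite [LHS](_ : _ = P^t* *m (diag_mx d *m delta_mx i 0)); last by rewrite mulmxA.
  rewrite scalemxAr; congr (_ *m _); apply/colP => j.
  by rewrite mul_diag_mx !mxE; case: eqP => [->|] //; rewrite !mulr0.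
have := congr1 (fun Y : 'M[R[i]]_n => (row i P *m Y *m (row i P)^t* ) 0 0) key.
rewrite /= mulmxDr mulmxDl !mulmxA rX -(mulmxA (row i P *m T)) Xr.
rewrite -!scalemxAl -scalemxAr mulmx0 mul0mx.
rewrite mxE [X in X + _]mxE [X in _ + X]mxE [RHS]mxE -mulrDr => /eqP.
rewrite mulf_eq0 => /orP[/eqP //|].
by rewrite gt_eqF // addr_gt0.
Qed.

Lemma sqrtmxP M : posdefmx M -> is_sqrtmx M (sqrtmx M).
Proof. by move=> /is_sqrtmx_exists[S MS]; apply: (xgetPex 0); exists S. Qed.

End SquareRoot.

(* Main.v *)
(** By the identity theorem det A is not flat at lambda, so
    A(k)^-1 = (det A)^-1 adj A = (k - lambda)^-m Q(k) with Q holomorphic,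
    Q(lambda) <> 0 and m >= 1; Q(lambda) is the leading coefficient P m.  Since
    the spectral norm is homogeneous and subadditive, the amplification is
    |k - lambda|^-m (|| M^(1/2) Q(lambda) M^(1/2) || + O(|k - lambda|)).
    A chain of length L amounts to a polynomial V(k) in k - lambda with
    V(lambda) <> 0 and A V = O((k - lambda)^L).  Multiplying by A^-1 forces
    L <= m, and truncating Q(k) w with Q(lambda) w <> 0 attains m.

    Holomorphic means complex differentiable, so Cauchy's theory is built from
    Goursat's bisection.  Working with squares avoids exp and pi: writing W(z)
    for the contour integral of 1 / (w - z), Cauchy's formula is
    f(z) W(z) = \oint f(w) / (w - z) dw, and all that is needed about W is that
    it is itself such an integral and does not vanish at the center. *)
Require Import Defs.
From HB Require Import structures.
From mathcomp Require Import all_boot all_order all_algebra.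
From mathcomp Require Import all_classical all_reals all_analysis.
From mathcomp Require Import perm complex ring lra.

Set Implicit Arguments.
Unset Strict Implicit.
Unset Printing Implicit Defensive.

Import Order.TTheory GRing.Theory Num.Theory.
Import numFieldNormedType.Exports.

Local Open Scope classical_set_scope.
Local Open Scope ring_scope.

(** Differentiability at every point comes without continuity of the derivative, so even the
    differentiability of f' has to be earned. Near l the integral formula reads f W = I, where I and
    W integrate the same kernel 1 / (w - z) against data on the contour. It is therefore enough to
    expand that kernel: 1 / (w - z) = 1 / (w - l) + (z - l) / ((w - l) (w - z)). One such step gives
    divided differences, and iterating these gives Taylor expansions. Iterating the step on I gives
    the order of a zero; if every coefficient is zero, then |f W| <= C q^n for all n with a fixed q
    < 1/2, hence f = 0. No power series is ever summed: all expansions are finite with a holomorphic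
    remainder, which reduces the statements about the pole and the chains to algebra modulo powers
    of k - lambda. The obstacle in the chain part is that a chain must consist of nonzero vectors
    only, whereas truncating Q(k) w controls the first one alone. *)

(** * The modulus as a real number *)

Section ComplexModulus.
Local Open Scope complex_scope.
Variable R : realType.
Implicit Types (z w : R[i]) (x y : R).

Lemma cabsE z : cabs z = Num.sqrt (complex.Re z ^+ 2 + complex.Im z ^+ 2).
Proof. by rewrite /cabs normc_def. Qed.

Lemma norm_cabs z : `|z| = (cabs z)%:C.
Proof. by rewrite cabsE normc_def. Qed.

Lemma cabs_ge0 z : 0 <= cabs z.
Proof. by rewrite cabsE sqrtr_ge0. Qed.

Lemma cabs0 : cabs (0 : R[i]) = 0.
Proof. by rewrite /cabs normr0. Qed.

Lemma cabs_eq0 z : (cabs z == 0) = (z == 0).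
Proof. by rewrite -[RHS]normr_eq0 norm_cabs eq_complex /= eqxx andbT. Qed.

Lemma cabs_gt0 z : (0 < cabs z) = (z != 0).
Proof. by rewrite lt_def cabs_ge0 andbT cabs_eq0. Qed.

Lemma cabsM z w : cabs (z * w) = cabs z * cabs w.
Proof. by apply: complexI; rewrite -norm_cabs normrM !norm_cabs rmorphM. Qed.

Lemma cabs1 : cabs (1 : R[i]) = 1.
Proof. by rewrite /cabs normr1. Qed.

Lemma cabsX z n : cabs (z ^+ n) = cabs z ^+ n.
Proof.
by elim: n => [|n IH]; rewrite ?expr0 ?cabs1 // !exprS cabsM IH.
Qed.

Lemma cabsV z : cabs z^-1 = (cabs z)^-1.
Proof. by apply: complexI; rewrite -norm_cabs normfV norm_cabs fmorphV. Qed.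

Lemma cabsN z : cabs (- z) = cabs z.
Proof. by rewrite /cabs normrN. Qed.

Lemma cabs_distC z w : cabs (z - w) = cabs (w - z).
Proof. by rewrite -cabsN opprB. Qed.

Lemma le_cabsD z w : cabs (z + w) <= cabs z + cabs w.
Proof. by rewrite -lecR rmorphD /= -!norm_cabs ler_normD. Qed.

Lemma le_cabsB z w : cabs (z - w) <= cabs z + cabs w.
Proof. by rewrite -(cabsN w) le_cabsD. Qed.

Lemma cabs_real x : cabs (x%:C) = `|x|.
Proof. by rewrite cabsE /= expr0n addr0 sqrtr_sqr. Qed.

Lemma cabs_i : cabs ('i : R[i]) = 1.
Proof. by rewrite cabsE /= expr0n expr1n add0r sqrtr1. Qed.

Lemma normRe_le_cabs z : `|complex.Re z| <= cabs z.
Proof. by rewrite cabsE -sqrtr_sqr ler_wsqrtr // lerDl sqr_ge0. Qed.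

Lemma normIm_le_cabs z : `|complex.Im z| <= cabs z.
Proof. by rewrite cabsE -sqrtr_sqr ler_wsqrtr // lerDr sqr_ge0. Qed.

Lemma cabs_le_ReIm z : cabs z <= `|complex.Re z| + `|complex.Im z|.
Proof.
rewrite {1}[z]complexE; apply: (le_trans (le_cabsD _ _)).
by rewrite cabsM cabs_i mul1r !cabs_real.
Qed.

Lemma le_cabs_sum (I : Type) (r : seq I) (P : pred I) (F : I -> R[i]) :
  cabs (\sum_(i <- r | P i) F i) <= \sum_(i <- r | P i) cabs (F i).
Proof.
elim/big_rec2: _ => [|i y1 y2 _ le]; first by rewrite cabs0.
by apply: (le_trans (le_cabsD _ _)); rewrite lerD2l.
Qed.

End ComplexModulus.

(** * Neighbourhoods, continuity and derivatives through the real-valued modulus *)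

Section ComplexTopology.
Local Open Scope complex_scope.
Variable R : realType.
Implicit Types (z w k : Cplx R).

(** Balls of the normed space have radii in [R[i]]. Positivity there forces the radius to be real,
    so its real part can replace it. *)
Lemma nbhs_cabsP z (P : set (Cplx R)) :
  (\forall k \near z, P k) <->
  exists2 e : R, 0 < e & forall k, cabs (k - z) < e -> P k.
Proof.
split=> [/nbhs_ballP [e /= e0 eP]|[e e0 eP]].
  exists (complex.Re e); first by move: e0; rewrite ltcE => /andP[].
  move=> k kz; apply: eP; rewrite -ball_normE /= -normrN opprB norm_cabs.
  rewrite ltcE /= kz andbT.
  by move: e0; rewrite ltcE => /andP[].
apply/nbhs_ballP; exists e%:C => /=; first by rewrite ltcR.
move=> k; rewrite -ball_normE /= -normrN opprB norm_cabs ltcR; exact: eP.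
Qed.

Lemma dnbhs_cabsP z (P : set (Cplx R)) :
  (\forall k \near z^', P k) <->
  exists2 e : R, 0 < e & forall k, k != z -> cabs (k - z) < e -> P k.
Proof.
split=> [/nbhs_cabsP[e e0 eP]|[e e0 eP]].
  by exists e => // k kz ke; apply: eP.
by apply/nbhs_cabsP; exists e => // k ke /= kz; apply: eP.
Qed.

Lemma continuous_cabsP (T : topologicalType) (f : T -> Cplx R) (x : T) :
  {for x, continuous f} <->
  (forall e : R, 0 < e -> \forall y \near x, cabs (f y - f x) < e).
Proof.
split=> [cf e e0|h].
  by apply: (cf [set w | cabs (w - f x) < e]); apply/nbhs_cabsP; exists e.
move=> P /nbhs_cabsP[e e0 eP]; apply: filterS (h e e0) => y; exact: eP.
Qed.

(** The division-free form needs no exception at k = z, and it is the form in which Goursat's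
    estimate and differentiation under the integral use a derivative. *)
Lemma is_derive_cabsP (f : Cplx R -> Cplx R) z d :
  is_derive z 1 f d <->
  (forall e : R, 0 < e -> \forall k \near z,
     cabs (f k - f z - d * (k - z)) <= e * cabs (k - z)).
Proof.
split=> [df e e0|h].
  have := @ex_derive _ _ _ _ _ _ _ df.
  have := @derive_val _ _ _ _ _ _ _ df => <- cf.
  have {}cf : (fun h : Cplx R => h^-1 *: (f (h *: 1 + z) - f z) : Cplx R) @
    (0 : Cplx R)^' --> 'D_1 f z.
    exact: cf.
  have : \forall h \near (0 : Cplx R)^',
      cabs (h^-1 *: (f (h *: 1 + z) - f z) - 'D_1 f z) < e.
    apply: (cf [set w | cabs (w - 'D_1 f z) < e]).
    by apply/nbhs_cabsP; exists e.
  move=> /dnbhs_cabsP[r r0 rP]; apply/nbhs_cabsP; exists r => // k kr.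
  have [->|kz] := eqVneq k z; first by rewrite !subrr mulr0 subr0 cabs0 mulr0.
  have kz0 : k - z != 0 by rewrite subr_eq0.
  have := rP (k - z) kz0; rewrite subr0 => /(_ kr).
  rewrite /GRing.scale /= mulr1 subrK => lte.
  have -> : f k - f z - 'D_1 f z * (k - z) =
     ((k - z)^-1 * (f k - f z) - 'D_1 f z) * (k - z).
    by rewrite mulrBl (mulrC (k - z)^-1) mulfVK.
  by rewrite cabsM ler_wpM2r ?cabs_ge0 // ltW.
have cv : (fun h : Cplx R => h^-1 *: (f (h *: 1 + z) - f z) : Cplx R) @
  (0 : Cplx R)^' --> d.
  move=> P /nbhs_cabsP[e e0 eP].
  have e20 : 0 < e / 2 by rewrite divr_gt0.
  have /nbhs_cabsP[r r0 rP] := h _ e20.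
  apply/dnbhs_cabsP; exists r => // k k0; rewrite subr0 => kr; apply: eP.
  have := rP (k + z); rewrite addrK => /(_ kr).
  rewrite /GRing.scale /= mulr1 => le.
  have -> : k^-1 * (f (k + z) - f z) - d = k^-1 * (f (k + z) - f z - d * k).
    by rewrite [RHS]mulrBr (mulrC d k) mulKf.
  rewrite cabsM cabsV mulrC ltr_pdivrMr ?cabs_gt0 //.
  apply: (le_lt_trans le); rewrite ltr_pM2r ?cabs_gt0 // ltr_pdivrMr //.
  by rewrite ltr_pMr // ltr1n.
by apply: DeriveDef; [apply/cvg_ex; exists d|apply: cvg_lim].
Qed.

Lemma derivable_cont (f : Cplx R -> Cplx R) z :
  derivable f z 1 -> {for z, continuous f}.
Proof.
move=> df; apply: differentiable_continuous.
exact/derivable1_diffP.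
Qed.

Section ComplexDerivable.
Variables (f g : Cplx R -> Cplx R) (z : Cplx R).
Hypotheses (df : derivable f z 1) (dg : derivable g z 1).

Lemma derivable_add : derivable (fun w => f w + g w : Cplx R) z 1.
Proof. exact: (derivableD df dg). Qed.

Lemma derivable_sub : derivable (fun w => f w - g w : Cplx R) z 1.
Proof. exact: (derivableB df dg). Qed.

Lemma derivable_mul : derivable (fun w => f w * g w : Cplx R) z 1.
Proof. exact: (derivableM df dg). Qed.

Lemma derivable_inv : f z != 0 -> derivable (fun w => (f w)^-1 : Cplx R) z 1.
Proof. by move=> fz; exact: (derivableV fz df). Qed.

End ComplexDerivable.

Lemma derivable_const (a z : Cplx R) : derivable (fun=> a : Cplx R) z 1.
Proof. exact: derivable_cst. Qed.

Lemma derivable_subc (a z : Cplx R) : derivable (fun w => w - a : Cplx R) z 1.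
Proof.
have dz : derivable (id : Cplx R -> Cplx R) z 1 by exact: derivable_id.
exact: (derivable_sub dz (@derivable_const a z)).
Qed.

Lemma continuous_Re : continuous (@complex.Re R : Cplx R -> R).
Proof.
move=> z; apply/(@cvgrPdist_lt _ _ _ (nbhs z) _) => e e0; apply/nbhs_cabsP;
  exists e => // k ke.
rewrite -normrN opprB; apply: le_lt_trans ke.
by rewrite -[leLHS]/(`|complex.Re k - complex.Re z|) -raddfB normRe_le_cabs.
Qed.

Lemma continuous_Im : continuous (@complex.Im R : Cplx R -> R).
Proof.
move=> z; apply/(@cvgrPdist_lt _ _ _ (nbhs z) _) => e e0; apply/nbhs_cabsP;
  exists e => // k ke.
rewrite -normrN opprB; apply: le_lt_trans ke.
by rewrite -[leLHS]/(`|complex.Im k - complex.Im z|) -raddfB normIm_le_cabs.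
Qed.

Lemma continuous_Complex (T : topologicalType) (f g : T -> R) (x : T) :
  {for x, continuous f} -> {for x, continuous g} ->
  {for x, continuous (fun t => (f t +i* g t : Cplx R))}.
Proof.
move=> cf cg; apply/continuous_cabsP => e e0.
have e20 : 0 < e / 2 by rewrite divr_gt0.
have /cvgrPdist_lt/(_ _ e20) hf := cf; have /cvgrPdist_lt/(_ _ e20) hg := cg.
near=> y; apply: (le_lt_trans (cabs_le_ReIm _)) => /=.
rewrite [e]splitr ltrD // distrC; [near: y; exact: hf|near: y; exact: hg].
Unshelve. all: by end_near. Qed.

End ComplexTopology.

(** * Complex line integrals *)

Section RealIntegral.
Local Open Scope complex_scope.
Variable R : realType.
Notation mu := (@lebesgue_measure R).
Implicit Types (f g : R -> R) (a b c k : R).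

(** For b < a this is 0 and not the integral with the opposite sign, hence the ordered endpoints in
    the lemmas below. *)
Definition rint f a b : R := (\int[mu]_(x in `[a, b]) f x)%R.

Lemma continuous_integrable f a b :
  continuous f -> mu.-integrable `[a, b] (EFin \o f).
Proof.
move=> cf; apply: continuous_compact_integrable; first exact: segment_compact.
exact: continuous_subspaceT.
Qed.

Lemma eq_rint f g a b :
  (forall x, a <= x <= b -> f x = g x) -> rint f a b = rint g a b.
Proof.
by move=> fg; apply: eq_Rintegral => x; rewrite inE /= in_itv /=; exact: fg.
Qed.

Lemma rintD f g a b : continuous f -> continuous g ->
  rint (fun x => f x + g x) a b = rint f a b + rint g a b.
Proof. by move=> cf cg; apply: RintegralD => //;
  exact: continuous_integrable. Qed.

Lemma rintZ k f a b : continuous f ->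
  rint (fun x => k * f x) a b = k * rint f a b.
Proof. by move=> cf; apply: RintegralZl => //;
  exact: continuous_integrable. Qed.

Lemma rint_cst k a b : a <= b -> rint (fun=> k) a b = k * (b - a).
Proof.
move=> ab; rewrite /rint Rintegral_cst //= lebesgue_measure_itv /= lte_fin.
by case: ltP => [//|ba]; rewrite (@le_anti _ _ b a) ?ab ?ba // subrr.
Qed.

Lemma le_rint f g a b : continuous f -> continuous g ->
  (forall x, a <= x <= b -> f x <= g x) -> rint f a b <= rint g a b.
Proof.
move=> cf cg fg; apply: le_Rintegral => //; try exact: continuous_integrable.
Qed.

Lemma rint_split f a c b : continuous f -> a <= c -> c <= b ->
  rint f a b = rint f a c + rint f c b.
Proof.
move=> cf ac cb; rewrite /rint.
have /(Rintegral_itvB (x := c)) : mu.-integrable `[a, b] (EFin \o f).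
  exact: continuous_integrable.
rewrite !bnd_simp => /(_ ac cb) /eqP; rewrite subr_eq => /eqP ->.
rewrite addrC Rintegral_itv_obnd_cbnd //.
apply: integrableS (continuous_integrable c b cf) => //.
by move=> x /=; rewrite !in_itv /= => /andP[/ltW -> ->].
Qed.

Lemma le_norm_rint f a b k : a <= b -> continuous f ->
  (forall x, a <= x <= b -> `|f x| <= k) -> `|rint f a b| <= k * (b - a).
Proof.
move=> ab cf fk; rewrite -rint_cst //.
apply: (le_trans (le_normr_Rintegral _ (continuous_integrable a b cf))) => //.
apply: le_rint => //.
  by move=> x; apply: continuous_comp; [exact: cf|exact: norm_continuous].
by move=> x; apply: cvg_cst.
Qed.

End RealIntegral.

Section ComplexIntegral.
Local Open Scope complex_scope.
Variable R : realType.
Implicit Types (f g : R -> Cplx R) (a b c : R) (k : R[i]).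

Definition cint f a b : R[i] :=
  rint (fun x => complex.Re (f x)) a b +i* rint (fun x => complex.Im (f x)) a b.

Lemma continuous_ReT f :
  continuous f -> continuous (fun x => complex.Re (f x)).
Proof. by move=> cf x; apply: continuous_comp (@continuous_Re R _);
  exact: cf. Qed.

Lemma continuous_ImT f :
  continuous f -> continuous (fun x => complex.Im (f x)).
Proof. by move=> cf x; apply: continuous_comp (@continuous_Im R _);
  exact: cf. Qed.

Hint Resolve continuous_ReT continuous_ImT : core.

Lemma eq_cint f g a b :
  (forall x, a <= x <= b -> f x = g x) -> cint f a b = cint g a b.
Proof.
by move=> fg; congr Complex; apply: eq_rint => x xab; rewrite fg.
Qed.

Lemma cintD f g a b : continuous f -> continuous g ->
  cint (fun x => f x + g x) a b = cint f a b + cint g a b.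
Proof.
move=> cf cg; apply/eqP; rewrite eq_complex /=; apply/andP; split; apply/eqP.
  by rewrite -rintD; auto; apply: eq_rint => x _; rewrite raddfD.
by rewrite -rintD; auto; apply: eq_rint => x _; rewrite raddfD.
Qed.

Lemma cintZ k f a b : continuous f ->
  cint (fun x => k * f x) a b = k * cint f a b.
Proof.
move=> cf; have cR := continuous_ReT cf; have cI := continuous_ImT cf.
have cZ p (h : R -> R) : continuous h -> continuous (fun x => p * h x).
  by move=> ch x; apply: cvgM; [exact: cvg_cst|exact: ch].
case: k => p q; apply/eqP; rewrite eq_complex /=; apply/andP; split; apply/eqP.
  rewrite -mulNr -!rintZ // -rintD; [|exact: cZ..].
  by apply: eq_rint => x _; case: (f x) => u v /=; rewrite mulNr.
rewrite -!rintZ // -rintD; [|exact: cZ..].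
by apply: eq_rint => x _; case: (f x) => u v /=.
Qed.

Lemma cint_cst k a b : a <= b -> cint (fun=> k) a b = k * (b - a)%:C.
Proof.
by move=> ab; case: k => p q; rewrite /cint /= !rint_cst //; simpc.
Qed.

Lemma cint_split f a c b : continuous f -> a <= c -> c <= b ->
  cint f a b = cint f a c + cint f c b.
Proof. by move=> cf ac cb; rewrite /cint !(@rint_split _ _ a c b); auto. Qed.

(** Real and imaginary parts are bounded separately, which costs the factor 2. Only the order of
    magnitude matters later. *)
Lemma le_cabs_cint f a b (K : R) : a <= b -> continuous f ->
  (forall x, a <= x <= b -> cabs (f x) <= K) ->
  cabs (cint f a b) <= 2 * K * (b - a).
Proof.
move=> ab cf fK; apply: (le_trans (cabs_le_ReIm _)) => /=.
rewrite -mulrA mulr_natl mulr2n; apply: lerD; apply: le_norm_rint; auto =>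
  x xab.
  exact: le_trans (normRe_le_cabs _) (fK x xab).
exact: le_trans (normIm_le_cabs _) (fK x xab).
Qed.

End ComplexIntegral.

Section RectangleIntegral.
Local Open Scope complex_scope.
Variable R : realType.
Implicit Types (f g : Cplx R -> Cplx R) (a b c d : R).

(* The integral of [f z dz] counterclockwise around the boundary of
   [a, b] x [c, d]. *)
Definition rectint f a b c d : R[i] :=
  cint (fun x => f (x +i* c) - f (x +i* d)) a b +
  'i * cint (fun y => f (b +i* y) - f (a +i* y)) c d.

Lemma continuous_hline f c :
  continuous f -> continuous (fun x => f (x +i* c)).
Proof.
move=> cf x; apply: continuous_comp (cf _).
by apply: continuous_Complex; [exact: cvg_id|exact: cvg_cst].
Qed.

Lemma continuous_vline f a :
  continuous f -> continuous (fun y => f (a +i* y)).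
Proof.
move=> cf x; apply: continuous_comp (cf _).
by apply: continuous_Complex; [exact: cvg_cst|exact: cvg_id].
Qed.

Lemma continuousB_fun (T : topologicalType) (f g : T -> Cplx R) :
  continuous f -> continuous g -> continuous (fun x => f x - g x).
Proof. by move=> cf cg x; apply: cvgB; [exact: cf|exact: cg]. Qed.

(** The common side is run through in opposite directions, so its two contributions cancel. *)
Lemma rectint_splitx f a m b c d : continuous f -> a <= m -> m <= b ->
  rectint f a b c d = rectint f a m c d + rectint f m b c d.
Proof.
move=> cf am mb; rewrite /rectint (@cint_split _ _ a m b) //; last first.
  by apply: continuousB_fun; exact: continuous_hline.
rewrite (@eq_cint _ (fun y => f (b +i* y) - f (a +i* y))
  (fun y => (f (m +i* y) - f (a +i* y)) + (f (b +i* y) - f (m +i* y)))).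
  rewrite (@cintD _ (fun y => f (m +i* y) - f (a +i* y))); last 2 first.
  - by apply: continuousB_fun; exact: continuous_vline.
  - by apply: continuousB_fun; exact: continuous_vline.
  by rewrite mulrDr addrACA.
by move=> y _; rewrite [RHS]addrC addrA subrK.
Qed.

Lemma rectint_splity f a b c m d : continuous f -> c <= m -> m <= d ->
  rectint f a b c d = rectint f a b c m + rectint f a b m d.
Proof.
move=> cf cm md; rewrite /rectint (@cint_split _ _ c m d) //; last first.
  by apply: continuousB_fun; exact: continuous_vline.
rewrite (@eq_cint _ (fun x => f (x +i* c) - f (x +i* d))
  (fun x => (f (x +i* c) - f (x +i* m)) + (f (x +i* m) - f (x +i* d)))).
  rewrite (@cintD _ (fun x => f (x +i* c) - f (x +i* m))); last 2 first.
  - by apply: continuousB_fun; exact: continuous_hline.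
  - by apply: continuousB_fun; exact: continuous_hline.
  by rewrite mulrDr addrACA.
by move=> y _; rewrite addrA subrK.
Qed.

Section RectangleSides.
Variables (a b c d : R).
Hypotheses (ab : a <= b) (cd : c <= d).

Lemma rectintD f g :
  continuous (fun x => f (x +i* c)) -> continuous (fun x => f (x +i* d)) ->
  continuous (fun y => f (a +i* y)) -> continuous (fun y => f (b +i* y)) ->
  continuous (fun x => g (x +i* c)) -> continuous (fun x => g (x +i* d)) ->
  continuous (fun y => g (a +i* y)) -> continuous (fun y => g (b +i* y)) ->
  rectint (fun z => f z + g z) a b c d = rectint f a b c d + rectint g a b c d.
Proof.
move=> f1 f2 f3 f4 g1 g2 g3 g4; rewrite /rectint.
rewrite (@eq_cint _ (fun x => f (x +i* c) + g (x +i* c) -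
  (f (x +i* d) + g (x +i* d)))
  (fun x => (f (x +i* c) - f (x +i* d)) + (g (x +i* c) - g (x +i* d))));
    last first.
  by move=> x _; ring.
rewrite (@eq_cint _ (fun y => f (b +i* y) + g (b +i* y) -
  (f (a +i* y) + g (a +i* y)))
  (fun y => (f (b +i* y) - f (a +i* y)) + (g (b +i* y) - g (a +i* y))));
    last first.
  by move=> x _; ring.
rewrite (cintD _ _ (continuousB_fun f1 f2) (continuousB_fun g1 g2)).
rewrite (cintD _ _ (continuousB_fun f4 f3) (continuousB_fun g4 g3)).
by rewrite mulrDr addrACA.
Qed.

Lemma rectintZ (k : R[i]) f :
  continuous (fun x => f (x +i* c)) -> continuous (fun x => f (x +i* d)) ->
  continuous (fun y => f (a +i* y)) -> continuous (fun y => f (b +i* y)) ->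
  rectint (fun z => k * f z) a b c d = k * rectint f a b c d.
Proof.
move=> f1 f2 f3 f4; rewrite /rectint.
rewrite (@eq_cint _ (fun x => k * f (x +i* c) - k * f (x +i* d))
  (fun x => k * (f (x +i* c) - f (x +i* d)))); last by move=> x _; ring.
rewrite (@eq_cint _ (fun y => k * f (b +i* y) - k * f (a +i* y))
  (fun y => k * (f (b +i* y) - f (a +i* y)))); last by move=> x _; ring.
rewrite (cintZ k _ _ (continuousB_fun f1 f2)).
rewrite (cintZ k _ _ (continuousB_fun f4 f3)).
by rewrite mulrDr (mulrCA 'i).
Qed.

Lemma le_cabs_rectint f (K : R) :
  continuous (fun x => f (x +i* c)) -> continuous (fun x => f (x +i* d)) ->
  continuous (fun y => f (a +i* y)) -> continuous (fun y => f (b +i* y)) ->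
  (forall x, a <= x <= b -> cabs (f (x +i* c)) <= K /\ cabs (f (x +i* d)) <= K)
    ->
  (forall y, c <= y <= d -> cabs (f (a +i* y)) <= K /\ cabs (f (b +i* y)) <= K)
    ->
  cabs (rectint f a b c d) <= 4 * K * (b - a + (d - c)).
Proof.
move=> f1 f2 f3 f4 fH fV; rewrite /rectint.
apply: (le_trans (le_cabsD _ _)); rewrite cabsM cabs_i mul1r.
have l1 : cabs (cint (fun x => f (x +i* c) - f (x +i* d)) a b) <=
  2 * (2 * K) * (b - a).
  apply: (le_cabs_cint ab (continuousB_fun f1 f2)).
  move=> t /fH[? ?]; apply: (le_trans (le_cabsB _ _)); rewrite mulr_natl mulr2n.
  exact: lerD.
have l2 : cabs (cint (fun y => f (b +i* y) - f (a +i* y)) c d) <=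
  2 * (2 * K) * (d - c).
  apply: (le_cabs_cint cd (continuousB_fun f4 f3)).
  move=> t /fV[? ?]; apply: (le_trans (le_cabsB _ _)); rewrite mulr_natl mulr2n.
  exact: lerD.
apply: (le_trans (lerD l1 l2)).
by rewrite le_eqVlt; apply/orP; left; apply/eqP; ring.
Qed.

End RectangleSides.

End RectangleIntegral.

(** * Goursat's theorem *)

Section Goursat.
Local Open Scope complex_scope.
Variable R : realType.
Implicit Types (f g : Cplx R -> Cplx R) (a b c d w h : R).

(** [P a c t] is meant for the rectangle with lower left corner a + i c and sides t w and t h. If it
    failed at scale 1, it would fail on some quarter at every halving, and the failing rectangles
    would shrink to a point where the local hypothesis applies. *)
Lemma rect_bisection (P : R -> R -> R -> Prop) a0 c0 w h : 0 < w -> 0 < h ->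
  (forall a c t, 0 < t -> P a c (t / 2) -> P (a + t / 2 * w) c (t / 2) ->
     P a (c + t / 2 * h) (t / 2) -> P (a + t / 2 * w) (c + t / 2 * h) (t / 2) ->
     P a c t) ->
  (forall p q, a0 <= p <= a0 + w -> c0 <= q <= c0 + h ->
     exists2 e, 0 < e & forall a c t, 0 < t < e ->
       a <= p <= a + t * w -> c <= q <= c + t * h -> P a c t) ->
  P a0 c0 1.
Proof.
move=> w0 h0 Psub Ploc; apply: contrapT => nP.
(* The corner of the failing quarter is quantified before the assumptions, so that a choice function
   defined on all pairs can be extracted. *)
have step (u : R * R) t : exists v : R * R, 0 < t -> ~ P u.1 u.2 t ->
    [/\ ~ P v.1 v.2 (t / 2), u.1 <= v.1 <= u.1 + t / 2 * w &
        u.2 <= v.2 <= u.2 + t / 2 * h].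
  have [[t0 nPu]|] := pselect (0 < t /\ ~ P u.1 u.2 t); last first.
    by move=> nn; exists u => t0 nPu; case: nn.
  have tw : 0 <= t / 2 * w by rewrite !mulr_ge0 // ?invr_ge0 // ltW.
  have th : 0 <= t / 2 * h by rewrite !mulr_ge0 // ?invr_ge0 // ltW.
  apply: contrapT => nn; apply: nPu; apply: Psub => //; apply: contrapT => nPi;
    apply: nn.
  - by exists (u.1, u.2) => _ _; split; rewrite //= lexx lerDl.
  - by exists (u.1 + t / 2 * w, u.2) => _ _; split; rewrite //=
    ?lexx ?lerDl ?andbT.
  - by exists (u.1, u.2 + t / 2 * h) => _ _; split; rewrite //=
    ?lexx ?lerDl ?andbT.
  - by exists (u.1 + t / 2 * w, u.2 + t / 2 * h) => _ _; split; rewrite //=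
    ?lexx ?lerDl ?andbT.
have [F FP] : {F : R * R -> R -> R * R & forall u t, 0 < t -> ~ P u.1 u.2 t ->
    [/\ ~ P (F u t).1 (F u t).2 (t / 2), u.1 <= (F u t).1 <= u.1 + t / 2 * w &
        u.2 <= (F u t).2 <= u.2 + t / 2 * h]}.
  exists (fun u t => sval (cid (step u t))) => u t;
    exact: (svalP (cid (step u t))).
pose r n : R := 2^-1 ^+ n.
have r0 n : 0 < r n by rewrite exprn_gt0 // invr_gt0.
have rS n : r n.+1 = r n / 2 by rewrite /r exprSr.
pose u := fix u n := if n is k.+1 then F (u k) (r k) else (a0, c0).
have uS n : u n.+1 = F (u n) (r n) by [].
have nPu n : ~ P (u n).1 (u n).2 (r n).
  elim: n => [|n IH]; first by rewrite /r expr0.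
  by rewrite uS rS; have [] := FP _ _ (r0 n) IH.
have st1 n : (u n).1 <= (u n.+1).1 <= (u n).1 + r n / 2 * w.
  by have [] := FP _ _ (r0 n) (nPu n).
have st2 n : (u n).2 <= (u n.+1).2 <= (u n).2 + r n / 2 * h.
  by have [] := FP _ _ (r0 n) (nPu n).
(* Nested intervals, one coordinate at a time: left ends increase, right ends decrease, and the
   supremum of the left ends lies in all the intervals. *)
have nest (v : nat -> R) k : 0 < k ->
    (forall n, v n <= v n.+1 <= v n + r n / 2 * k) ->
    exists p, forall n, v n <= p <= v n + r n * k.
  move=> k0 vst.
  have inc n m : (n <= m)%N -> v n <= v m.
    move/subnKC <-; elim: (m - n)%N => [|j IH]; first by rewrite addn0.
    by rewrite addnS (le_trans IH) //; case/andP: (vst (n + j)%N).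
  have dec n m : (n <= m)%N -> v m + r m * k <= v n + r n * k.
    move/subnKC <-; elim: (m - n)%N => [|j IH]; first by rewrite addn0.
    rewrite addnS; apply: le_trans IH.
    have /andP[_ le] := vst (n + j)%N; apply: (le_trans (lerD le (lexx _))).
    by rewrite rS -addrA -mulrDl -splitr.
  have ub n m : v m <= v n + r n * k.
    apply: (@le_trans _ _ (v (maxn n m))); first by apply: inc; exact: leq_maxr.
    apply: (@le_trans _ _ (v (maxn n m) + r (maxn n m) * k)).
      by rewrite lerDl mulr_ge0 // ltW.
    by apply: dec; exact: leq_maxl.
  exists (sup (range v)) => n; apply/andP; split.
    apply: ub_le_sup; last by exists n.
    by exists (v 0%N + r 0%N * k) => _ [m _ <-]; exact: ub.
  apply: ge_sup; first by exists (v 0%N); exists 0%N.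
  by move=> _ [m _ <-]; exact: ub.
have [p pP] := nest (fun n => (u n).1) w w0 st1.
have [q qP] := nest (fun n => (u n).2) h h0 st2.
have := pP 0%N; have := qP 0%N; rewrite /r /= expr0 !mul1r => q0 p0.
have [e e0 eP] := Ploc p q p0 q0.
have : \forall n \near \oo, `|0 - r n| < e.
  have : r @ \oo --> 0.
    by apply: cvg_expr; rewrite ger0_norm ?invf_lt1 ?ltr1n // invr_ge0.
  by move/cvgrPdist_lt; apply.
case=> n _ /(_ n (leqnn n)); rewrite sub0r normrN gtr0_norm // => rne.
by apply: (nPu n); apply: eP; rewrite ?r0 ?rne ?pP ?qP.
Qed.

(* Near [p + i q] the integrand is affine up to [e t], so the rectangle of
   scale [t] contributes at most a multiple of [e t^2]. *)
Lemma goursat_rect f a b c d : a < b -> c < d -> continuous f ->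
  (forall x y, a <= x <= b -> c <= y <= d -> derivable f (x +i* y) 1) ->
  rectint f a b c d = 0.
Proof.
move=> ab cd cf df; apply/eqP; rewrite -cabs_eq0 eq_le cabs_ge0 andbT.
pose w := b - a; pose h := d - c.
have w0 : 0 < w by rewrite subr_gt0.
have h0 : 0 < h by rewrite subr_gt0.
have wh0 : 0 < w + h by rewrite addr_gt0.
apply/ler_addgt0Pl => e0 e00; rewrite addr0.
(* Makes the bound in [P] equal to [e0] at scale 1. *)
pose e := e0 / (4 * (w + h) ^+ 2).
have K0 : 0 < 4 * (w + h) ^+ 2 by rewrite mulr_gt0 // exprn_gt0.
have e_gt0 : 0 < e by rewrite divr_gt0.
pose P a c t := cabs (rectint f a (a + t * w) c (c + t * h)) <=
   4 * e * (w + h) ^+ 2 * t ^+ 2.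
suff : P a c 1.
  rewrite /P.
  have -> : a + 1 * w = b by rewrite /w; ring.
  have -> : c + 1 * h = d by rewrite /h; ring.
  move=> /le_trans; apply.
  by rewrite expr1n mulr1 mulrAC mulrC /e mulfVK ?gt_eqF.
apply: (@rect_bisection P a c w h w0 h0).
  (* Halving the scale divides the bound by 4, so the bounds of the four quarters add up exactly to
     that of the whole. *)
  move=> a' c' t t0 P1 P2 P3 P4; rewrite /P.
  have tw : 0 <= t / 2 * w by rewrite !mulr_ge0 // ?invr_ge0 // ltW.
  have th : 0 <= t / 2 * h by rewrite !mulr_ge0 // ?invr_ge0 // ltW.
  have tE k : t * k = t / 2 * k + t / 2 * k by rewrite -mulrDl -splitr.
  rewrite (@rectint_splitx _ f a' (a' + t / 2 * w)) ?lerDl //; last first.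
    by rewrite lerD2l (tE w) lerDl.
  rewrite !(@rectint_splity _ f _ _ c' (c' + t / 2 * h) (c' + t * h)) ?lerDl //;
    try
    by rewrite lerD2l (tE h) lerDl.
  rewrite (tE w) (tE h) (addrA a') (addrA c'); rewrite /P in P1 P2 P3 P4.
  set A1 := rectint f a' (a' + t / 2 * w) c' (c' + t / 2 * h) in P1 *.
  set A2 := rectint f (a' + t / 2 * w) _ c' (c' + t / 2 * h) in P2 *.
  set A3 := rectint f a' (a' + t / 2 * w) (c' + t / 2 * h) _ in P3 *.
  set A4 := rectint f (a' + t / 2 * w) _ (c' + t / 2 * h) _ in P4 *.
  have l1 := le_cabsD (A1 + A3) (A2 + A4).
  have l2 := le_cabsD A1 A3; have l3 := le_cabsD A2 A4.
  apply: (le_trans l1); apply: (le_trans (lerD l2 l3)).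
  apply: (le_trans (lerD (lerD P1 P3) (lerD P2 P4))).
  by rewrite le_eqVlt; apply/orP; left; apply/eqP; field.
move=> p q pP qP.
have pab : a <= p <= b by move: pP; rewrite /w addrC subrK.
have qcd : c <= q <= d by move: qP; rewrite /h addrC subrK.
have /derivableP dfz := df p q pab qcd.
set D := 'D_1 f (p +i* q) in dfz.
have /is_derive_cabsP/(_ e e_gt0)/nbhs_cabsP[r r0 rP] := dfz.
exists (r / (w + h)); first by rewrite divr_gt0.
move=> a' c' t /andP[t0 tr] pa qc.
have twh : t * (w + h) < r by rewrite -ltr_pdivlMr.
have est x y : a' <= x <= a' + t * w -> c' <= y <= c' + t * h ->
    cabs (f (x +i* y) - f (p +i* q) - D * ((x +i* y) - (p +i* q))) <=
    e * (t * (w + h)).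
  move=> xa yc.
  have le : cabs ((x +i* y) - (p +i* q)) <= t * (w + h).
    apply: (le_trans (cabs_le_ReIm _)) => /=; rewrite mulrDr lerD //.
      by rewrite ler_distl; move: xa pa => /andP[? ?] /andP[? ?]; lra.
    by rewrite ler_distl; move: yc qc => /andP[? ?] /andP[? ?]; lra.
  apply: (le_trans (rP _ (le_lt_trans le twh))).
  by rewrite ler_wpM2l // ltW.
have tw : 0 <= t * w by rewrite mulr_ge0 // ltW.
have th : 0 <= t * h by rewrite mulr_ge0 // ltW.
have Ea : a' + t * w - a' = t * w by ring.
have Ec : c' + t * h - c' = t * h by ring.
(* The added constants remove the affine part of f from each pair of opposite sides. After
   integration they contribute D i (t h) (t w) and its opposite, so the integral over the rectangle
   is unchanged. *)
pose H x := f (x +i* c') - f (x +i* (c' + t * h)) + D * (0 +i* (t * h)).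
pose V y := f ((a' + t * w) +i* y) - f (a' +i* y) + - D * (t * w)%:C.
have cH : continuous (fun x => f (x +i* c') - f (x +i* (c' + t * h))).
  by apply: continuousB_fun; exact: continuous_hline.
have cV : continuous (fun y => f ((a' + t * w) +i* y) - f (a' +i* y)).
  by apply: continuousB_fun; exact: continuous_vline.
have ck k : continuous (fun _ : R => k : Cplx R) by move=> x; exact: cvg_cst.
have cHk : continuous H.
  by move=> x; apply: cvgD; [exact: cH|exact: ck].
have cVk : continuous V.
  by move=> x; apply: cvgD; [exact: cV|exact: ck].
have eqB : rectint f a' (a' + t * w) c' (c' + t * h) =
   cint H a' (a' + t * w) + 'i * cint V c' (c' + t * h).
  rewrite /rectint /H /V (cintD _ _ cH (ck _)) (cintD _ _ cV (ck _)).
  rewrite !cint_cst ?lerDl // Ea Ec.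
  have -> : (0 +i* (t * h)) = 'i * (t * h)%:C by simpc.
  ring.
rewrite /P eqB.
have bH x : a' <= x <= a' + t * w -> cabs (H x) <= 2 * (e * (t * (w + h))).
  move=> xa.
  have e1 := est x c' xa; have e2 := est x (c' + t * h) xa.
  rewrite lexx lerDl th in e1; rewrite lexx lerDl th in e2.
  have -> : H x = (f (x +i* c') - f (p +i* q) - D * ((x +i* c') - (p +i* q))) -
    (f (x +i* (c' + t * h)) - f (p +i* q) - D *
      ((x +i* (c' + t * h)) - (p +i* q))).
    rewrite /H.
    have -> : (0 +i* (t * h)) = (x +i* (c' + t * h)) - (x +i* c').
      by apply/eqP; rewrite eq_complex /= subrr (addrC c') addrK !eqxx.
    ring.
  apply: (le_trans (le_cabsB _ _)).
  by have := e1 isT; have := e2 isT; lra.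
have bV y : c' <= y <= c' + t * h -> cabs (V y) <= 2 * (e * (t * (w + h))).
  move=> yc.
  have e1 := est a' y _ yc; have e2 := est (a' + t * w) y _ yc.
  rewrite lexx lerDl tw in e1; rewrite lexx lerDl tw in e2.
  have -> : V y = (f ((a' + t * w) +i* y) - f (p +i* q) - D *
    (((a' + t * w) +i* y) - (p +i* q))) -
    (f (a' +i* y) - f (p +i* q) - D * ((a' +i* y) - (p +i* q))).
    rewrite /V.
    have -> : (t * w)%:C = ((a' + t * w) +i* y) - (a' +i* y).
      by apply/eqP; rewrite eq_complex /= subrr (addrC a') addrK !eqxx.
    ring.
  apply: (le_trans (le_cabsB _ _)).
  by have := e1 isT; have := e2 isT; lra.
apply: (le_trans (le_cabsD _ _)); rewrite cabsM cabs_i mul1r.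
have := le_cabs_cint _ cHk bH; have := le_cabs_cint _ cVk bV.
rewrite !lerDl tw th => /(_ isT) l1 /(_ isT) l2.
apply: (le_trans (lerD l2 l1)); rewrite Ea Ec.
by rewrite le_eqVlt; apply/orP; left; apply/eqP; ring.
Qed.

Lemma rectint_near0 g x0 y0 : continuous g -> forall e : R, 0 < e ->
  exists2 r, 0 < r & forall n, 0 < n < r ->
    cabs (rectint g (x0 - n) (x0 + n) (y0 - n) (y0 + n)) <= e.
Proof.
move=> cg e e0.
have /continuous_cabsP/(_ 1 ltr01)/nbhs_cabsP[r1 r10 r1P] := cg (x0 +i* y0).
pose K := cabs (g (x0 +i* y0)) + 1.
have K0 : 0 < K by rewrite ltr_wpDl ?cabs_ge0.
(* Each pair of opposite sides has length 2 n and an integrand of modulus at most 2 K, hence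
   contributes at most 2 (2 K) (2 n); together this is 16 K n. The half of [r1] is for each of the
   two coordinates. *)
exists (Num.min (r1 / 2) (e / (16 * K))).
  by rewrite lt_min !divr_gt0 // mulr_gt0.
move=> n /andP[n0]; rewrite lt_min => /andP[nr1 ne].
have bg x y : x0 - n <= x <= x0 + n -> y0 - n <= y <= y0 + n ->
    cabs (g (x +i* y)) <= K.
  move=> xP yP.
  have : cabs ((x +i* y) - (x0 +i* y0)) < r1.
    apply: (le_lt_trans (cabs_le_ReIm _)) => /=.
    rewrite [r1]splitr; apply: ltrD; apply: le_lt_trans nr1;
      by rewrite ler_distl.
  move=> /r1P lt1; rewrite -(subrK (g (x0 +i* y0)) (g (x +i* y))).
  apply: (le_trans (le_cabsD _ _)); rewrite /K addrC lerD2l; exact: ltW.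
have ln (z : R) : z - n <= z + n by lra.
have inn (z : R) : (z - n <= z - n <= z + n) && (z - n <= z + n <= z + n).
  by rewrite !lexx !ln.
rewrite /rectint.
have cH : continuous (fun x => g (x +i* (y0 - n)) - g (x +i* (y0 + n))).
  by apply: continuousB_fun; exact: continuous_hline.
have cV : continuous (fun y => g ((x0 + n) +i* y) - g ((x0 - n) +i* y)).
  by apply: continuousB_fun; exact: continuous_vline.
have bH x : x0 - n <= x <= x0 + n ->
    cabs (g (x +i* (y0 - n)) - g (x +i* (y0 + n))) <= 2 * K.
  move=> xP; apply: (le_trans (le_cabsB _ _)); rewrite mulr_natl mulr2n.
  by have /andP[? ?] := inn y0; apply: lerD; exact: bg.
have bV y : y0 - n <= y <= y0 + n ->
    cabs (g ((x0 + n) +i* y) - g ((x0 - n) +i* y)) <= 2 * K.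
  move=> yP; apply: (le_trans (le_cabsB _ _)); rewrite mulr_natl mulr2n.
  by have /andP[? ?] := inn x0; apply: lerD; exact: bg.
apply: (le_trans (le_cabsD _ _)); rewrite cabsM cabs_i mul1r.
have l1 := le_cabs_cint (ln x0) cH bH; have l2 := le_cabs_cint (ln y0) cV bV.
apply: (le_trans (lerD l1 l2)).
have : n * (16 * K) <= e by rewrite -ler_pdivlMr ?mulr_gt0 // ltW.
lra.
Qed.

(** A small square around the exceptional point is cut out. The four remaining rectangles fall under
    [goursat_rect], and the square contributes arbitrarily little. The intended g is a difference
    quotient, which at its base point is only known to be continuous. *)
Lemma goursat_punctured g a b c d x0 y0 : a < x0 < b -> c < y0 < d ->
  continuous g ->
  (forall x y, a <= x <= b -> c <= y <= d -> x +i* y != x0 +i* y0 ->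
     derivable g (x +i* y) 1) ->
  rectint g a b c d = 0.
Proof.
move=> /andP[ax xb] /andP[cy yd] cg dg.
apply/eqP; rewrite -cabs_eq0 eq_le cabs_ge0 andbT.
apply/ler_addgt0Pl => e e0; rewrite addr0.
have [r r0 rP] := rectint_near0 x0 y0 cg e0.
pose M := Num.min (Num.min r (x0 - a))
  (Num.min (b - x0) (Num.min (y0 - c) (d - y0))).
have M0 : 0 < M by rewrite !lt_min r0 !subr_gt0 ax xb cy yd.
pose n := M / 2.
have n0 : 0 < n by rewrite divr_gt0.
have : n < M by rewrite ltr_pdivrMr // ltr_pMr // ltr1n.
rewrite !lt_min => /andP[/andP[nr na] /and3P[nb nc nd]].
have neq x y : (x != x0) || (y != y0) -> x +i* y != x0 +i* y0.
  by rewrite eq_complex /= negb_and.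
rewrite (@rectint_splitx _ g a (x0 - n)) //; [|lra|lra].
rewrite (@rectint_splitx _ g (x0 - n) (x0 + n) b) //; [|lra|lra].
rewrite (@rectint_splity _ g (x0 - n) (x0 + n) c (y0 - n)) //; [|lra|lra].
rewrite (@rectint_splity _ g (x0 - n) (x0 + n) (y0 - n) (y0 + n)) //;
  [|lra|lra].
have z1 : rectint g a (x0 - n) c d = 0.
  apply: goursat_rect => //; [lra|lra|] => x y /andP[? ?] /andP[? ?].
  apply: dg; [lra|lra|apply: neq; rewrite lt_eqF //; lra].
have z2 : rectint g (x0 + n) b c d = 0.
  apply: goursat_rect => //; [lra|lra|] => x y /andP[? ?] /andP[? ?].
  apply: dg; [lra|lra|apply: neq; rewrite gt_eqF //; lra].
have z3 : rectint g (x0 - n) (x0 + n) c (y0 - n) = 0.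
  apply: goursat_rect => //; [lra|lra|] => x y /andP[? ?] /andP[? ?].
  apply: dg; [lra|lra|apply: neq; rewrite orbC lt_eqF //; lra].
have z4 : rectint g (x0 - n) (x0 + n) (y0 + n) d = 0.
  apply: goursat_rect => //; [lra|lra|] => x y /andP[? ?] /andP[? ?].
  apply: dg; [lra|lra|apply: neq; rewrite orbC gt_eqF //; lra].
rewrite z1 z2 z3 z4 !add0r !addr0; apply: rP; lra.
Qed.

End Goursat.

Lemma continuous_cabs (R : realType) : continuous (@cabs R : Cplx R -> R).
Proof.
move=> z; apply/(@cvgrPdist_lt _ _ _ (nbhs z) _) => e e0; apply/nbhs_cabsP.
exists e => // k ke; apply: le_lt_trans ke; rewrite ler_distl.
have := le_cabsD z (k - z); have := le_cabsD k (z - k).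
rewrite (addrC z (k - z)) (addrC k (z - k)) !subrK (cabs_distC z) => l1 l2.
by apply/andP; split; lra.
Qed.

(** * Cauchy's formula on a square *)

Section SquareContour.
Local Open Scope complex_scope.
Variables (R : realType) (l : Cplx R) (s : R).
Hypothesis s0 : 0 < s.
Implicit Types (f g : Cplx R -> Cplx R) (z k : Cplx R).
Let a := complex.Re l - s.
Let b := complex.Re l + s.
Let c := complex.Im l - s.
Let d := complex.Im l + s.

Definition sqint f : R[i] := rectint f a b c d.

Definition on_square z := exists t : R,
  (a <= t <= b /\ (z = t +i* c \/ z = t +i* d)) \/
  (c <= t <= d /\ (z = a +i* t \/ z = b +i* t)).

(** Continuity along the four full lines carrying the sides is what the integral lemmas consume.
    Continuity on the plane would exclude the kernel, which blows up inside the square. *)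
Definition side_continuous f :=
  [/\ continuous (fun x => f (x +i* c)), continuous (fun x => f (x +i* d)),
      continuous (fun y => f (a +i* y)) & continuous (fun y => f (b +i* y))].

Let sN : - s <= s. Proof. by have := s0; lra. Qed.
Let ab : a <= b. Proof. by rewrite lerD2l sN. Qed.
Let cd : c <= d. Proof. by rewrite lerD2l sN. Qed.
Let ba : b - a = 2 * s. Proof. by rewrite /b /a; ring. Qed.
Let dc : d - c = 2 * s. Proof. by rewrite /d /c; ring. Qed.

Lemma on_square_cabs z : on_square z -> s <= cabs (z - l).
Proof.
have aN : `|a - complex.Re l| =
  s by rewrite /a addrAC subrr add0r normrN gtr0_norm.
have bN : `|b - complex.Re l| = s by rewrite /b addrAC subrr add0r gtr0_norm.
have cN : `|c - complex.Im l| =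
  s by rewrite /c addrAC subrr add0r normrN gtr0_norm.
have dN : `|d - complex.Im l| = s by rewrite /d addrAC subrr add0r gtr0_norm.
have hI (w : R[i]) : `|complex.Im w - complex.Im l| <= cabs (w - l).
  by rewrite -raddfB normIm_le_cabs.
have hR (w : R[i]) : `|complex.Re w - complex.Re l| <= cabs (w - l).
  by rewrite -raddfB normRe_le_cabs.
case=> t [] [_ [->|->]].
- by apply: le_trans (hI _); rewrite /= cN.
- by apply: le_trans (hI _); rewrite /= dN.
- by apply: le_trans (hR _); rewrite /= aN.
- by apply: le_trans (hR _); rewrite /= bN.
Qed.

(** This is why parameters stay in the disk of radius s / 2: there the kernel 1 / (w - z) is bounded
    by 2 / s, uniformly on the contour. *)
Lemma on_square_dist z w : on_square w -> cabs (z - l) < s / 2 ->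
  s / 2 <= cabs (w - z).
Proof.
move=> /on_square_cabs sw sz; have := le_cabsD (w - z) (z - l).
by rewrite addrA subrK => h; lra.
Qed.

Lemma eq_sqint f g : (forall z, on_square z -> f z = g z) -> sqint f = sqint g.
Proof.
move=> fg; rewrite /sqint /rectint; congr (_ + _ * _); apply: eq_cint => t tP.
  by rewrite !fg //; exists t; left; split=> //; [right|left].
by rewrite !fg //; exists t; right; split=> //; [left|right].
Qed.

Lemma sqintD f g : side_continuous f -> side_continuous g ->
  sqint (fun z => f z + g z) = sqint f + sqint g.
Proof.
by move=> [f1 f2 f3 f4] [g1 g2 g3 g4];
  exact: (rectintD f1 f2 f3 f4 g1 g2 g3 g4).
Qed.

Lemma sqintZ (k : R[i]) f : side_continuous f ->
  sqint (fun z => k * f z) = k * sqint f.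
Proof.
by move=> [f1 f2 f3 f4]; exact: (rectintZ k f1 f2 f3 f4).
Qed.

Lemma side_continuous_cst (k : Cplx R) : side_continuous (fun=> k).
Proof. by split=> x; exact: cvg_cst. Qed.

Lemma side_continuousM f g : side_continuous f -> side_continuous g ->
  side_continuous (fun z => f z * g z).
Proof.
by move=> [f1 f2 f3 f4] [g1 g2 g3 g4]; split=> x; apply: cvgM;
  [exact: f1|exact: g1|exact: f2|exact: g2|exact: f3|exact: g3|exact: f4|exact:
    g4].
Qed.

Lemma side_continuousD f g : side_continuous f -> side_continuous g ->
  side_continuous (fun z => f z + g z).
Proof.
by move=> [f1 f2 f3 f4] [g1 g2 g3 g4]; split=> x; apply: cvgD;
  [exact: f1|exact: g1|exact: f2|exact: g2|exact: f3|exact: g3|exact: f4|exact: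
    g4].
Qed.

Lemma side_continuousX f n : side_continuous f ->
  side_continuous (fun z => f z ^+ n).
Proof.
move=> cf; elim: n => [|n IH]; first exact: side_continuous_cst.
have := side_continuousM cf IH.
by under [X in side_continuous X -> _]eq_fun do rewrite -exprS.
Qed.

Lemma continuous_side f : continuous f -> side_continuous f.
Proof.
by move=> cf; split; [exact: continuous_hline|exact: continuous_hline|
  exact: continuous_vline|exact: continuous_vline].
Qed.

(** Both coordinates of z differ from those of l by less than s, so z avoids even the extended lines
    and w - z never vanishes on them. *)
Lemma side_continuous_inv z : cabs (z - l) < s ->
  side_continuous (fun w => (w - z)^-1).
Proof.
move=> zs.
have hI : `|complex.Im z - complex.Im l| < s.
  by rewrite -raddfB; apply: le_lt_trans zs; exact: normIm_le_cabs.
have hR : `|complex.Re z - complex.Re l| < s.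
  by rewrite -raddfB; apply: le_lt_trans zs; exact: normRe_le_cabs.
rewrite !ltr_distl in hI hR.
have [cz zd] := andP hI; have [az zb] := andP hR.
have hl u : continuous (fun x : R => (x +i* u : Cplx R)).
  by move=> x; apply: continuous_Complex; [exact: cvg_id|exact: cvg_cst].
have vl u : continuous (fun x : R => (u +i* x : Cplx R)).
  by move=> x; apply: continuous_Complex; [exact: cvg_cst|exact: cvg_id].
have inv (h : R -> Cplx R) : continuous h -> (forall x, h x != z) ->
    continuous (fun x => (h x - z)^-1).
  move=> ch hz x; apply: cvgV; first by rewrite subr_eq0.
  by apply: cvgB; [exact: ch|exact: cvg_cst].
have neq x y : (x != complex.Re z) || (y != complex.Im z) -> x +i* y != z.
  by rewrite eq_complex /= negb_and.
split.
- by apply: inv (hl c) _ => x; rewrite neq // (lt_eqF cz) orbT.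
- by apply: inv (hl d) _ => x; rewrite neq // (gt_eqF zd) orbT.
- by apply: inv (vl a) _ => x; rewrite neq // (lt_eqF az).
- by apply: inv (vl b) _ => x; rewrite neq // (gt_eqF zb).
Qed.

Lemma side_continuous_bounded f : side_continuous f ->
  exists2 K : R, 0 < K & forall z, on_square z -> cabs (f z) <= K.
Proof.
move=> [f1 f2 f3 f4].
have bd (g : R -> Cplx R) u v : u <= v -> continuous g ->
    exists K : R, forall x, u <= x <= v -> cabs (g x) <= K.
  move=> uv cg; have [|p _ pP] := @EVT_max R (fun x => cabs (g x)) u v uv.
    apply: continuous_subspaceT => x;
      apply: continuous_comp (@continuous_cabs R _).
    exact: cg.
  by exists (cabs (g p)) => x; have := pP x; rewrite in_itv.
have [K1 h1] := bd _ _ _ ab f1; have [K2 h2] := bd _ _ _ ab f2.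
have [K3 h3] := bd _ _ _ cd f3; have [K4 h4] := bd _ _ _ cd f4.
exists (`|K1| + `|K2| + `|K3| + `|K4| + 1).
  by rewrite ltr_wpDl // !addr_ge0.
have := (ler_norm K1, ler_norm K2, ler_norm K3, ler_norm K4).
have := (normr_ge0 K1, normr_ge0 K2, normr_ge0 K3, normr_ge0 K4).
move=> [[[? ?] ?] ?] [[[? ?] ?] ?].
move=> z [t [] [tP [->|->]]].
- by apply: (le_trans (h1 _ tP)); lra.
- by apply: (le_trans (h2 _ tP)); lra.
- by apply: (le_trans (h3 _ tP)); lra.
- by apply: (le_trans (h4 _ tP)); lra.
Qed.

Lemma le_cabs_sqint f (K : R) : side_continuous f ->
  (forall z, on_square z -> cabs (f z) <= K) -> cabs (sqint f) <= 16 * s * K.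
Proof.
move=> [f1 f2 f3 f4] fK.
have -> : 16 * s * K = 4 * K * (b - a + (d - c)) by rewrite ba dc; ring.
apply: (le_cabs_rectint ab cd f1 f2 f3 f4) => t tP; split; apply: fK; exists t;
  [left|left|right|right];
  split=> //; by [left|right].
Qed.

(** A Cauchy-type integral without the factor 1 / (2 pi i). Here f is mere data on the contour and
    need not be holomorphic; differentiating in z raises n. *)
Definition cauchy_int n f z : R[i] := sqint (fun w => f w * (w - z)^-1 ^+ n).

Lemma side_continuous_cauchy n f z : cabs (z - l) < s -> side_continuous f ->
  side_continuous (fun w => f w * (w - z)^-1 ^+ n).
Proof.
move=> zs cf.
exact: (side_continuousM cf (side_continuousX n (side_continuous_inv zs))).
Qed.

Let half_lt z : cabs (z - l) < s / 2 -> cabs (z - l) < s.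
Proof. by move=> zs; have := s0; lra. Qed.

Let inv_le z w : cabs (z - l) < s / 2 -> on_square w ->
  cabs (w - z)^-1 <= 2 / s /\ w - z != 0.
Proof.
move=> zs sw; have le := on_square_dist sw zs.
have s20 : 0 < s / 2 by rewrite divr_gt0.
have gt0 : 0 < cabs (w - z) by exact: lt_le_trans le.
split; last by rewrite -cabs_gt0.
by rewrite cabsV -[2 / s]invf_div lef_pV2 ?posrE.
Qed.

Let near_half z : cabs (z - l) < s / 2 ->
  \forall k \near z, cabs (k - l) < s / 2.
Proof.
move=> zs; apply/nbhs_cabsP; exists (s / 2 - cabs (z - l));
  first by rewrite subr_gt0.
move=> k kz; have := le_cabsD (k - z) (z - l); rewrite addrA subrK => h; lra.
Qed.

(** Differentiation under the integral sign: a remainder of the kernel that is quadratic in k - z,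
    uniformly on the contour, stays quadratic after integration. *)
Lemma is_derive_cauchy n f z (K : R) : cabs (z - l) < s / 2 ->
  side_continuous f ->
  (forall w k, on_square w -> cabs (k - l) < s / 2 ->
    cabs (f w * ((w - k)^-1 ^+ n - (w - z)^-1 ^+ n -
      n%:R * (w - z)^-1 ^+ n.+1 * (k - z))) <= K * cabs (k - z) ^+ 2) ->
  is_derive z 1 (cauchy_int n f : Cplx R -> Cplx R)
    (n%:R * cauchy_int n.+1 f z).
Proof.
move=> zs cf hK; apply/is_derive_cabsP => e e0.
(* [K] is not assumed nonnegative, and [K'] must be positive to be divided by. *)
pose K' := 16 * s * `|K| + 1.
have K'0 : 0 < K'.
  by rewrite /K' ltr_wpDl // mulr_ge0 // mulr_ge0 // ltW.
have : \forall k \near z, cabs (k - z) < e / K'.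
  by apply/nbhs_cabsP; exists (e / K') => //; rewrite divr_gt0.
apply: filterS2 (near_half zs) => k ks ke.
have cn := side_continuous_cauchy n (half_lt zs) cf.
have cn1 := side_continuous_cauchy n.+1 (half_lt zs) cf.
have cnk := side_continuous_cauchy n (half_lt ks) cf.
have cN g : side_continuous g -> side_continuous (fun w => -1 * g w).
  by move=> cg; exact: (side_continuousM (side_continuous_cst _) cg).
have cZ (p : Cplx R) g : side_continuous g ->
  side_continuous (fun w => p * g w).
  by move=> cg; exact: (side_continuousM (side_continuous_cst _) cg).
have eqI : cauchy_int n f k - cauchy_int n f z - n%:R * cauchy_int n.+1 f z *
  (k - z) =
    sqint (fun w => f w * ((w - k)^-1 ^+ n - (w - z)^-1 ^+ n -
      n%:R * (w - z)^-1 ^+ n.+1 * (k - z))).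
  rewrite (@eq_sqint _ (fun w => (f w * (w - k)^-1 ^+ n +
     -1 * (f w * (w - z)^-1 ^+ n)) +
     (- (n%:R * (k - z))) * (f w * (w - z)^-1 ^+ n.+1))); last first.
    by move=> w _; ring.
  apply: (@etrans _ _ (cauchy_int n f k + -1 * cauchy_int n f z +
      - (n%:R * (k - z)) * cauchy_int n.+1 f z)).
    by move: (cauchy_int n f k) (cauchy_int n f z) (cauchy_int n.+1 f z) =>
      u v w; ring.
  apply/esym/(etrans (sqintD (side_continuousD cnk (cN _ cn)) (cZ _ _ cn1))).
  exact: (congr2 +%R (etrans (sqintD cnk (cN _ cn))
    (congr1 (+%R (cauchy_int n f k)) (sqintZ (-1) cn))) (sqintZ _ cn1)).
rewrite eqI; apply: (@le_trans _ _ (16 * s * (K * cabs (k - z) ^+ 2))).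
  apply: le_cabs_sqint => [|w sw]; last exact: hK.
  have -> : (fun w => f w * ((w - k)^-1 ^+ n - (w - z)^-1 ^+ n -
      n%:R * (w - z)^-1 ^+ n.+1 * (k - z))) = (fun w => (f w * (w - k)^-1 ^+ n +
     -1 * (f w * (w - z)^-1 ^+ n)) +
     (- (n%:R * (k - z))) * (f w * (w - z)^-1 ^+ n.+1)).
    by apply/funext => w; ring.
  exact: (side_continuousD (side_continuousD cnk (cN _ cn)) (cZ _ _ cn1)).
rewrite expr2 !mulrA ler_wpM2r ?cabs_ge0 //.
apply: (@le_trans _ _ (K' * cabs (k - z))).
  rewrite ler_wpM2r ?cabs_ge0 // /K'.
  apply: (@le_trans _ _ (16 * s * `|K|)); last by rewrite lerDl.
  by rewrite ler_wpM2l ?ler_norm // mulr_ge0 // ltW.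
by rewrite mulrC -ler_pdivlMr // ltW.
Qed.

Lemma is_derive_cauchy1 f z : cabs (z - l) < s / 2 -> side_continuous f ->
  is_derive z 1 (cauchy_int 1 f : Cplx R -> Cplx R) (cauchy_int 2 f z).
Proof.
move=> zs cf; rewrite -[cauchy_int 2 f z]mul1r.
have [K K0 fK] := side_continuous_bounded cf.
(* The exact remainder below has three inverse factors, each at most 2 / s, besides the bound [K]
   for f. *)
apply: (@is_derive_cauchy 1 _ _ (K * (2 / s) ^+ 3)) => // w k sw ks.
have [Uk wk] := inv_le ks sw; have [Uz wz] := inv_le zs sw.
have -> : (w - k)^-1 ^+ 1 - (w - z)^-1 ^+ 1 - 1%:R * (w - z)^-1 ^+ 2 * (k - z) =
  (w - k)^-1 * (w - z)^-1 ^+ 2 * (k - z) ^+ 2 by field; rewrite wk wz.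
rewrite 3!cabsM !cabsX mulrA ler_wpM2r ?exprn_ge0 ?cabs_ge0 //.
apply: ler_pM; rewrite ?cabs_ge0 ?mulr_ge0 ?exprn_ge0 ?cabs_ge0 ?fK //.
rewrite [leRHS]exprS; apply: ler_pM; rewrite ?exprn_ge0 ?cabs_ge0 //.
by rewrite lerXn2r ?nnegrE ?cabs_ge0 // divr_ge0 // ltW.
Qed.

Lemma derivable_cauchy2 f z : cabs (z - l) < s / 2 -> side_continuous f ->
  derivable (cauchy_int 2 f : Cplx R -> Cplx R) z 1.
Proof.
move=> zs cf.
have [K K0 fK] := side_continuous_bounded cf.
suff dc2 : is_derive z 1 (cauchy_int 2 f : Cplx R -> Cplx R)
  (2%:R * cauchy_int 3 f z).
  exact: ex_derive.
(* Now the remainder has three inverse factors times a sum that is at most 3 (2 / s). *)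
apply: (@is_derive_cauchy 2 _ _ (K * (3 * (2 / s) ^+ 4))) => // w k sw ks.
have [Uk wk] := inv_le ks sw; have [Uz wz] := inv_le zs sw.
have -> : (w - k)^-1 ^+ 2 - (w - z)^-1 ^+ 2 - 2%:R * (w - z)^-1 ^+ 3 * (k - z) =
  (w - k)^-1 * (w - z)^-1 ^+ 2 * ((w - k)^-1 + 2 * (w - z)^-1) * (k - z) ^+ 2.
  by field; rewrite wk wz.
have B0 : 0 <= 2 / s by rewrite divr_ge0 // ltW.
rewrite 4!cabsM !cabsX mulrA ler_wpM2r ?exprn_ge0 ?cabs_ge0 //.
apply: ler_pM; rewrite ?cabs_ge0 ?mulr_ge0 ?exprn_ge0 ?cabs_ge0 ?fK //.
have -> : 3 * (2 / s) ^+ 4 = (2 / s) * (2 / s) ^+ 2 * (3 * (2 / s)) by ring.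
apply: ler_pM; rewrite ?cabs_ge0 ?mulr_ge0 ?exprn_ge0 ?cabs_ge0 //.
  apply: ler_pM; rewrite ?exprn_ge0 ?cabs_ge0 //.
  by rewrite lerXn2r ?nnegrE ?cabs_ge0.
apply: (le_trans (le_cabsD _ _)); rewrite cabsM.
have -> : cabs (2 : R[i]) = 2 by rewrite -(rmorph_nat (real_complex R))
  cabs_real ger0_norm.
lra.
Qed.

(** The partial fraction identity for the kernel, integrated. It peels off one Taylor coefficient at
    l and leaves a remainder of the same type, with data divided by w - l. *)
Lemma cauchy_step f z : cabs (z - l) < s / 2 -> side_continuous f ->
  cauchy_int 1 f z = cauchy_int 1 f l + (z - l) * cauchy_int 1
    (fun w => f w * (w - l)^-1) z.
Proof.
move=> zs cf; have ll : cabs (l - l) < s / 2 by rewrite subrr cabs0 divr_gt0.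
have cl := side_continuous_cauchy 1 (half_lt ll) cf.
have cM := side_continuousM cf (side_continuous_inv (half_lt ll)).
have cz := side_continuous_cauchy 1 (half_lt zs) cM.
rewrite /cauchy_int -(sqintZ _ cz).
rewrite -(sqintD cl (side_continuousM (side_continuous_cst _) cz)).
apply: eq_sqint => w sw; have [_ wz] := inv_le zs sw; have [_ wl] :=
  inv_le ll sw.
by field; rewrite wz wl.
Qed.

(** The difference quotient of f at z, completed by f'(z), is continuous and differentiable off z
    inside the square, so [goursat_punctured] makes its integral vanish. On the contour it splits
    into f(w) / (w - z) and - f(z) / (w - z). *)
Lemma cauchy_formula f z : cabs (z - l) < s / 2 -> continuous f ->
  (forall x y, a <= x <= b -> c <= y <= d -> derivable f (x +i* y) 1) ->
  f z * cauchy_int 1 (fun=> 1) z = cauchy_int 1 f z.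
Proof.
move=> zs cf df.
have hI : `|complex.Im z - complex.Im l| < s.
  by rewrite -raddfB; apply: le_lt_trans (half_lt zs); exact: normIm_le_cabs.
have hR : `|complex.Re z - complex.Re l| < s.
  by rewrite -raddfB; apply: le_lt_trans (half_lt zs); exact: normRe_le_cabs.
rewrite !ltr_distl in hI hR.
have zE : z = complex.Re z +i* complex.Im z by case: (z).
have [/ltW c1 /ltW c2] := andP hI; have [/ltW a1 /ltW b1] := andP hR.
have dz : derivable f z 1.
  by rewrite zE; apply: df; apply/andP; split.
pose g w := if w == z then 'D_1 f z else (f w - f z) * (w - z)^-1.
have dg w : w != z -> derivable f w 1 -> derivable g w 1.
  move=> wz dfw; apply: (@near_eq_derivable _ _ _
    (fun w => (f w - f z) * (w - z)^-1)).
    apply/nbhs_cabsP; exists (cabs (w - z)); first by rewrite cabs_gt0 subr_eq0.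
    move=> k kw; rewrite /g; case: eqP => // kz.
    by move: kw; rewrite kz cabs_distC ltxx.
  have wz0 : w - z != 0 by rewrite subr_eq0.
  exact: (derivable_mul (derivable_sub dfw (@derivable_const R (f z) w))
    (derivable_inv (@derivable_subc R z w) wz0)).
have cg : continuous g.
  move=> w; have [->|wz] := eqVneq w z.
    apply/continuous_cabsP => e e0; have e20 : 0 < e / 2 by rewrite divr_gt0.
    have /derivableP/is_derive_cabsP/(_ _ e20) := dz.
    apply: filterS => k; rewrite /g eqxx; case: eqP => [_ _|/eqP kz le].
      by rewrite subrr cabs0.
    have kz0 : k - z != 0 by rewrite subr_eq0.
    rewrite -(ltr_pM2r (_ : 0 < cabs (k - z))) ?cabs_gt0 // -cabsM mulrBl mulfVK
      //.
    apply: (le_lt_trans le); rewrite ltr_pM2r ?cabs_gt0 //.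
    by rewrite ltr_pdivrMr // ltr_pMr // ltr1n.
  have cw : {for w, continuous (fun w => (f w - f z) * (w - z)^-1)}.
    have wz0 : w - z != 0 by rewrite subr_eq0.
    have c1w : (fun w => f w - f z : Cplx R) @ w --> f w - f z.
      exact: (cvgB (cf w) (cvg_cst (f z))).
    have c2w : (fun w => (w - z)^-1 : Cplx R) @ w --> (w - z)^-1.
      exact: (cvgV wz0 (derivable_cont (@derivable_subc R z w))).
    exact: (cvgM c1w c2w).
  apply/continuous_cabsP => e e0; move/continuous_cabsP/(_ e e0) : cw.
  have : \forall k \near w, cabs (k - w) < cabs (w - z).
    by apply/nbhs_cabsP; exists (cabs (w - z)); rewrite ?cabs_gt0 ?subr_eq0.
  apply: filterS2 => k kw; rewrite /g (negbTE wz); case: eqP => // kz.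
  by move: kw; rewrite kz cabs_distC ltxx.
have : sqint g = 0.
  have dgz x y : a <= x <= b -> c <= y <= d ->
      x +i* y != complex.Re z +i* complex.Im z -> derivable g (x +i* y) 1.
    by move=> xP yP; rewrite -zE => xyz; exact: dg xyz (df _ _ xP yP).
  exact: (@goursat_punctured _ g a b c d _ _ hR hI cg dgz).
have c1z := side_continuous_inv (half_lt zs).
have cfz := side_continuous_cauchy 1 (half_lt zs) (continuous_side cf).
have c1z' := side_continuous_cauchy 1 (half_lt zs) (side_continuous_cst 1).
rewrite (@eq_sqint _ (fun w => f w * (w - z)^-1 ^+ 1 +
    (- f z) * (1 * (w - z)^-1 ^+ 1))); last first.
  move=> w sw; have [_] := inv_le zs sw; rewrite subr_eq0 => wz.
  by rewrite /g (negbTE wz); ring.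
move/(etrans (esym (etrans (sqintD cfz
  (side_continuousM (side_continuous_cst (- f z)) c1z'))
  (congr1 (+%R (cauchy_int 1 f z)) (sqintZ _ c1z'))))).
by rewrite -/(cauchy_int 1 (fun=> 1) z) mulNr => /subr0_eq ->.
Qed.

(** A crude lower bound on the imaginary part suffices. Each pair of opposite sides contributes the
    integral of [h], and [h] is at least 1 / s on a segment of length 2 s, so the imaginary part is
    at least 4. *)
Lemma cauchy_one_neq0 : cauchy_int 1 (fun=> 1) l != 0.
Proof.
pose h (t u : R) : R := 2 * s / ((t - u) ^+ 2 + s ^+ 2).
have den t u : 0 < (t - u) ^+ 2 + s ^+ 2.
  by rewrite ltr_wpDl ?sqr_ge0 // exprn_gt0.
have ch u : continuous (h ^~ u).
  move=> t; apply: cvgM; first exact: cvg_cst.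
  apply: cvgV; first by rewrite gt_eqF.
  apply: cvgD; last exact: cvg_cst.
  by apply: cvgM; (apply: cvgB; [exact: cvg_id|exact: cvg_cst]).
have rh u : 2 <= rint (h ^~ u) (u - s) (u + s).
  have E : u + s - (u - s) = 2 * s by ring.
  have -> : 2 = rint (fun=> s^-1) (u - s) (u + s).
    by rewrite rint_cst; [rewrite E; field; rewrite gt_eqF|have := s0; lra].
  apply: le_rint => // [x|x /andP[x1 x2]]; first exact: cvg_cst.
  have xs : (x - u) ^+ 2 <= s ^+ 2.
    have y1 : 0 <= s - (x - u) by lra.
    have y2 : 0 <= s + (x - u) by lra.
    by have := mulr_ge0 y1 y2; lra.
  rewrite /h ler_pdivlMr // mulrC ler_pdivrMr //; lra.
suff : 0 < complex.Im (cauchy_int 1 (fun=> 1) l).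
  by apply: contraTneq => ->; rewrite ltxx.
have ReV (u v : R) : complex.Re (u +i* v)^-1 = u / (u ^+ 2 + v ^+ 2) by [].
have ImV (u v : R) : complex.Im (u +i* v)^-1 = - (v / (u ^+ 2 + v ^+ 2)) by [].
have ImB (z w : R[i]) : complex.Im (z - w) = complex.Im z - complex.Im w.
  by rewrite raddfB.
have ReB (z w : R[i]) : complex.Re (z - w) = complex.Re z - complex.Re w.
  by rewrite raddfB.
have Im1 : rint (fun x => complex.Im (1 * ((x +i* c) - l)^-1 ^+ 1 -
    1 * ((x +i* d) - l)^-1 ^+ 1)) a b = rint (h ^~ (complex.Re l)) a b.
  apply: eq_rint => x _; rewrite !mul1r !expr1 ImB.
  have -> : (x +i* c) - l = (x - complex.Re l) +i* (- s).
    by apply/eqP; rewrite eq_complex !raddfB /= /c addrAC subrr add0r !eqxx.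
  have -> : (x +i* d) - l = (x - complex.Re l) +i* s.
    by apply/eqP; rewrite eq_complex !raddfB /= /d addrAC subrr add0r !eqxx.
  rewrite !ImV /h; field; rewrite ?gt_eqF ?sqrrN //.
have Re1 : rint (fun x => complex.Re (1 * ((b +i* x) - l)^-1 ^+ 1 -
    1 * ((a +i* x) - l)^-1 ^+ 1)) c d = rint (h ^~ (complex.Im l)) c d.
  apply: eq_rint => x _; rewrite !mul1r !expr1 ReB.
  have -> : (a +i* x) - l = (- s) +i* (x - complex.Im l).
    by apply/eqP; rewrite eq_complex !raddfB /= /a addrAC subrr add0r !eqxx.
  have -> : (b +i* x) - l = s +i* (x - complex.Im l).
    by apply/eqP; rewrite eq_complex !raddfB /= /b addrAC subrr add0r !eqxx.
  rewrite !ReV /h; field; rewrite ?gt_eqF //.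
have -> : complex.Im (cauchy_int 1 (fun=> 1) l) =
    rint (h ^~ (complex.Re l)) a b + rint (h ^~ (complex.Im l)) c d.
  by rewrite -Im1 -Re1 /cauchy_int /sqint /rectint raddfD /= mul0r mul1r add0r.
have := rh (complex.Re l); have := rh (complex.Im l); rewrite -/a -/b -/c -/d.
by move=> h1 h2; apply: lt_le_trans (lerD h2 h1).
Qed.

End SquareContour.

(** * Local theory of holomorphic functions *)

Section LocallyHolomorphic.
Local Open Scope complex_scope.
Variable R : realType.
Implicit Types (f g : Cplx R -> Cplx R) (l z k : Cplx R).

Definition holo_at f l := \forall k \near l, derivable f k 1.

Lemma holo_at_near f l : holo_at f l -> \forall k \near l, holo_at f k.
Proof. exact: nbhs_interior. Qed.

Lemma holo_at_derivable f l : holo_at f l -> derivable f l 1.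
Proof. exact: nbhs_singleton. Qed.

Lemma holo_at_eq f g l : (\forall k \near l, f k = g k) ->
  holo_at f l -> holo_at g l.
Proof.
move=> fg hf; apply: filterS2 (nbhs_interior fg) hf => k fgk.
exact: near_eq_derivable.
Qed.

Lemma holo_at_entire f l : (forall k, derivable f k 1) -> holo_at f l.
Proof. by move=> df; apply/nbhs_cabsP; exists 1. Qed.

Lemma holo_at_cst (a : Cplx R) l : holo_at (fun=> a) l.
Proof. by apply: holo_at_entire => k; exact: derivable_const. Qed.

Lemma holo_at_subc (a : Cplx R) l : holo_at (fun k => k - a) l.
Proof. by apply: holo_at_entire => k; exact: derivable_subc. Qed.

Lemma holo_at_add f g l : holo_at f l -> holo_at g l ->
  holo_at (fun k => f k + g k) l.
Proof. by move=> hf hg; apply: filterS2 hf hg => k; exact: derivable_add. Qed.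

Lemma holo_at_mul f g l : holo_at f l -> holo_at g l ->
  holo_at (fun k => f k * g k) l.
Proof. by move=> hf hg; apply: filterS2 hf hg => k; exact: derivable_mul. Qed.

Lemma holo_at_neq0 f l : holo_at f l -> f l != 0 ->
  \forall k \near l, f k != 0.
Proof.
move=> /holo_at_derivable/derivable_cont/continuous_cabsP cf fl.
have fl0 : 0 < cabs (f l) by rewrite cabs_gt0.
apply: filterS (cf _ fl0) => k; apply: contraTneq => ->.
by rewrite sub0r cabsN ltxx.
Qed.

Lemma holo_at_inv f l : holo_at f l -> f l != 0 ->
  holo_at (fun k => (f k)^-1) l.
Proof.
move=> hf fl; apply: filterS2 (holo_at_neq0 hf fl) hf => k fk dk.
exact: derivable_inv.
Qed.

Lemma holo_at_sum (I : Type) (r : seq I) (P : pred I)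
  (F : I -> Cplx R -> Cplx R) l :
  (forall i, P i -> holo_at (F i) l) ->
  holo_at (fun k => \sum_(i <- r | P i) F i k) l.
Proof.
move=> hF; elim: r => [|i r IH].
  by under eq_fun do rewrite big_nil; exact: holo_at_cst.
under eq_fun do rewrite big_cons; case: (boolP (P i)) => Pi; last exact: IH.
exact: (holo_at_add (hF i Pi) IH).
Qed.

Lemma holo_at_prod (I : Type) (r : seq I) (P : pred I)
  (F : I -> Cplx R -> Cplx R) l :
  (forall i, P i -> holo_at (F i) l) ->
  holo_at (fun k => \prod_(i <- r | P i) F i k) l.
Proof.
move=> hF; elim: r => [|i r IH].
  by under eq_fun do rewrite big_nil; exact: holo_at_cst.
under eq_fun do rewrite big_cons; case: (boolP (P i)) => Pi; last exact: IH.
exact: (holo_at_mul (hF i Pi) IH).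
Qed.

Lemma holo_at_exp f n l : holo_at f l -> holo_at (fun k => f k ^+ n) l.
Proof.
move=> hf; elim: n => [|n IH].
  by under eq_fun do rewrite expr0; exact: holo_at_cst.
under eq_fun do rewrite exprS; exact: (holo_at_mul hf IH).
Qed.

(** Identities obtained after dividing by k - l hold only off l; continuity carries them over to l
    itself. *)
Lemma dnbhs_eq f g l : derivable f l 1 -> derivable g l 1 ->
  (\forall k \near l^', f k = g k) -> f l = g l.
Proof.
move=> /derivable_cont/continuous_cabsP cf /derivable_cont/continuous_cabsP cg.
move=> /dnbhs_cabsP[r r0 fg]; apply/eqP; rewrite -subr_eq0 -cabs_eq0.
rewrite eq_le cabs_ge0 andbT; apply/ler_addgt0Pl => e e0; rewrite addr0.
have e20 : 0 < e / 2 by rewrite divr_gt0.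
have /nbhs_cabsP[r1 r10 h1] := cf _ e20; have /nbhs_cabsP[r2 r20 h2] :=
  cg _ e20.
pose t := Num.min r (Num.min r1 r2) / 2.
have m0 : 0 < Num.min r (Num.min r1 r2) by rewrite !lt_min r0 r10 r20.
have t0 : 0 < t by rewrite divr_gt0.
have : t < Num.min r (Num.min r1 r2) by rewrite ltr_pdivrMr // ltr_pMr // ltr1n.
rewrite !lt_min => /and3P[tr t1 t2].
have tl : cabs (l + t%:C - l) =
  t by rewrite addrAC subrr add0r cabs_real gtr0_norm.
have E : f (l + t%:C) = g (l + t%:C).
  apply: fg; last by rewrite tl.
  by rewrite -subr_eq0 -cabs_eq0 tl gt_eqF.
have := h1 (l + t%:C); have := h2 (l + t%:C); rewrite tl -E =>
  /(_ t2) l2 /(_ t1) l1.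
have := le_cabsD (f l - f (l + t%:C)) (f (l + t%:C) - g l).
rewrite addrA subrK (cabs_distC (f l) (f (l + t%:C))) => l3; lra.
Qed.

Definition clampr (m s x : R) := Num.max (m - s) (Num.min (m + s) x).

Lemma continuous_clampr m s : continuous (clampr m s).
Proof.
move=> x; have cc (k : R) : {for x, continuous (fun _ : R => k : R^o)} by exact:
  cvg_cst.
exact: (continuous_max (cc (m - s)) (continuous_min (cc (m + s)) cvg_id)).
Qed.

Lemma clampr_dist m s x : 0 <= s -> `|clampr m s x - m| <= s.
Proof.
move=> s0; rewrite ler_distl /clampr le_max lexx /= ge_max ge_min lexx /= andbT.
lra.
Qed.

Lemma clampr_id m s x : `|x - m| <= s -> clampr m s x = x.
Proof.
by rewrite ler_distl => /andP[h1 h2];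
  rewrite /clampr (min_idPr h2) (max_idPr h1).
Qed.

(* Precomposing with the clamp onto a square makes the function continuous on
   the whole plane, as the integral lemmas require. *)
Lemma cauchy_representation f l : holo_at f l ->
  exists (s : R) (F : Cplx R -> Cplx R), [/\ 0 < s, side_continuous l s F &
    forall z, cabs (z - l) < s / 2 ->
      f z * cauchy_int l s 1 (fun=> 1) z = cauchy_int l s 1 F z].
Proof.
move=> /nbhs_cabsP[r r0 rP].
(* The clamp uses the half-side 2 s and not s, so that F agrees with f around every point of the
   closed square bounded by the contour and is differentiable there. Points of the clamped square
   are within 4 s = r / 2 of l. *)
pose s := r / 8.
have s0 : 0 < s by rewrite divr_gt0.
have s20 : 0 <= 2 * s by rewrite mulr_ge0 // ltW.
pose cl (z : Cplx R) : Cplx R :=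
  clampr (complex.Re l) (2 * s) (complex.Re z) +i* clampr (complex.Im l) (2 * s)
    (complex.Im z).
have ReB (z w : R[i]) : complex.Re (z - w) = complex.Re z - complex.Re w.
  by rewrite raddfB.
have ImB (z w : R[i]) : complex.Im (z - w) = complex.Im z - complex.Im w.
  by rewrite raddfB.
have cl_dist z : cabs (cl z - l) < r.
  apply: (le_lt_trans (cabs_le_ReIm _)); rewrite ReB ImB /=.
  apply: (le_lt_trans (lerD (clampr_dist _ _ s20) (clampr_dist _ _ s20))).
  by rewrite /s; move: r0; lra.
have ccl : continuous cl.
  move=> z.
  have h1 := continuous_comp (@continuous_Re R z)
    (@continuous_clampr (complex.Re l) (2 * s) (complex.Re z)).
  have h2 := continuous_comp (@continuous_Im R z)
    (@continuous_clampr (complex.Im l) (2 * s) (complex.Im z)).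
  exact: (continuous_Complex h1 h2).
pose F z := f (cl z).
have cF : continuous F.
  move=> z; exact: (continuous_comp (ccl z)
    (derivable_cont (rP _ (cl_dist z)))).
have cl_id z : `|complex.Re z - complex.Re l| <= 2 * s ->
    `|complex.Im z - complex.Im l| <= 2 * s -> cl z = z.
  by move=> h1 h2; rewrite /cl !clampr_id //; case: (z).
have FE z : cabs (z - l) < s / 2 -> F z = f z.
  move=> zs; rewrite /F cl_id // -?ReB -?ImB.
    apply: (le_trans (normRe_le_cabs _)); apply: (le_trans (ltW zs)).
    by move: s0; lra.
  apply: (le_trans (normIm_le_cabs _)); apply: (le_trans (ltW zs)).
  by move: s0; lra.
exists s, F; split => //; first exact: continuous_side.
move=> z zs; rewrite -(FE _ zs); apply: cauchy_formula => // x y xP yP.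
have xl : `|x - complex.Re l| <= s by rewrite ler_distl.
have yl : `|y - complex.Im l| <= s by rewrite ler_distl.
have clxy : cl (x +i* y) = x +i* y.
  by rewrite cl_id //=; [apply: (le_trans xl)|apply: (le_trans yl)]; move: s0;
    lra.
apply: (@near_eq_derivable _ _ _ f); last by apply: rP; rewrite -clxy.
apply/nbhs_cabsP; exists s => // k ks; rewrite /F cl_id //.
  have := ler_normD (complex.Re k - x) (x - complex.Re l); rewrite addrA subrK.
  have := normRe_le_cabs (k - (x +i* y)); rewrite ReB /=.
  by move: xl ks; move: (cabs _) => u; lra.
have := ler_normD (complex.Im k - y) (y - complex.Im l); rewrite addrA subrK.
have := normIm_le_cabs (k - (x +i* y)); rewrite ImB /=.
by move: yl ks; move: (cabs _) => u; lra.
Qed.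

Lemma near_half_ball l (s : R) : 0 < s -> \forall k \near l,
  cabs (k - l) < s / 2.
Proof. by move=> s0; apply/nbhs_cabsP; exists (s / 2) => //;
  rewrite divr_gt0. Qed.

Lemma holo_at_cauchy l (s : R) F : 0 < s -> side_continuous l s F ->
  holo_at (cauchy_int l s 1 F : Cplx R -> Cplx R) l.
Proof.
move=> s0 cF; apply: filterS (near_half_ball l s0) => k ks.
exact: (@ex_derive _ _ _ _ _ _ _ (is_derive_cauchy1 s0 ks cF)).
Qed.

(** Differentiating f W = I gives f' = (I' - f W') / W, where I' and W' are Cauchy-type integrals
    with n = 2. Every ingredient on the right is again differentiable. *)
Lemma derivable_derive1_holo f l : holo_at f l -> derivable (derive1 f) l 1.
Proof.
move=> hf; have [s [F [s0 cF fF]]] := cauchy_representation hf.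
set W := cauchy_int l s 1 (fun=> 1) in fF.
have c1 := side_continuous_cst l s (1 : Cplx R).
have hW : holo_at W l by exact: holo_at_cauchy.
have nh := near_half_ball l s0.
have ll : cabs (l - l) < s / 2 by rewrite subrr cabs0 divr_gt0.
have W0 : W l != 0 by exact: cauchy_one_neq0.
pose g : Cplx R -> Cplx R :=
  fun k => (cauchy_int l s 2 F k - f k * cauchy_int l s 2 (fun=> 1) k) *
    (W k)^-1.
apply: (@near_eq_derivable _ _ _ g).
  apply: filterS3 (nbhs_interior nh) (holo_at_neq0 hW W0) hf => k nk Wk dfk.
  have ks := nbhs_singleton nk.
  have dW := is_derive_cauchy1 s0 ks c1; have dF := is_derive_cauchy1 s0 ks cF.
  have := near_eq_derive (1 : Cplx R) (filterS fF nk).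
  have /(@derive_val _ _ _ _ _ _ _) -> := dF.
  rewrite (deriveM dfk (@ex_derive _ _ _ _ _ _ _ dW)).
  have /(@derive_val _ _ _ _ _ _ _) -> := dW.
  rewrite derive1E /g => <-; rewrite addrAC /GRing.scale /= subrr add0r.
  by rewrite -/W (mulrC (W k)) mulfK.
have d2F := derivable_cauchy2 s0 ll cF; have d21 := derivable_cauchy2 s0 ll c1.
have df := holo_at_derivable hf.
exact: (derivable_mul (derivable_sub d2F (derivable_mul df d21))
  (derivable_inv (holo_at_derivable hW) W0)).
Qed.

Lemma holo_at_derive1 f l : holo_at f l -> holo_at (derive1 f) l.
Proof.
by move=> /holo_at_near; apply: filterS => k; exact: derivable_derive1_holo.
Qed.

(** [cauchy_step] expands both f W and W. In f W - f(l) W the constant terms cancel, which leaves (k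
    - l) times an expression defined and holomorphic at l too. *)
Lemma holo_at_divided_difference f l : holo_at f l ->
  exists2 g, holo_at g l & \forall k \near l, f k = f l + (k - l) * g k.
Proof.
move=> hf; have [s [F [s0 cF fF]]] := cauchy_representation hf.
set W := cauchy_int l s 1 (fun=> 1) in fF.
have c1 := side_continuous_cst l s (1 : Cplx R).
have hW : holo_at W l by exact: holo_at_cauchy.
have nh := near_half_ball l s0.
have ll : cabs (l - l) < s / 2 by rewrite subrr cabs0 divr_gt0.
have ll' : cabs (l - l) < s by rewrite subrr cabs0.
have W0 : W l != 0 by exact: cauchy_one_neq0.
have cFl := side_continuousM cF (side_continuous_inv ll').
have c1l := side_continuousM c1 (side_continuous_inv ll').
pose g : Cplx R -> Cplx R := fun k =>
  (cauchy_int l s 1 (fun w => F w * (w - l)^-1) k -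
   f l * cauchy_int l s 1 (fun w => 1 * (w - l)^-1) k) * (W k)^-1.
exists g.
  have h1 := holo_at_cauchy s0 cFl.
  have h2 := holo_at_mul (holo_at_cst (- f l) l) (holo_at_cauchy s0 c1l).
  have := holo_at_mul (holo_at_add h1 h2) (holo_at_inv hW W0).
  by apply: holo_at_eq; apply/nbhs_cabsP; exists 1 => // k _; rewrite /g mulNr.
apply: filterS2 nh (holo_at_neq0 hW W0) => k ks Wk.
apply: (mulIf Wk); rewrite mulrDl /g mulrA (mulfVK Wk) (fF _ ks).
rewrite (cauchy_step s0 ks cF) -(fF _ ll) {2}/W (cauchy_step s0 ks c1) -/W.
move: (cauchy_int _ _ _ _ _) (cauchy_int _ _ _ _ _) (W l) => u v w; ring.
Qed.

Lemma holo_at_order f l : holo_at f l ->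
  (\forall k \near l, f k = 0) \/
  exists p g, [/\ holo_at g l, g l != 0 & \forall k \near l, f k =
    (k - l) ^+ p * g k].
Proof.
move=> hf; have [s [F [s0 cF fF]]] := cauchy_representation hf.
set W := cauchy_int l s 1 (fun=> 1) in fF.
have c1 := side_continuous_cst l s (1 : Cplx R).
have hW : holo_at W l by exact: holo_at_cauchy.
have nh := near_half_ball l s0.
have ll : cabs (l - l) < s / 2 by rewrite subrr cabs0 divr_gt0.
have ll' : cabs (l - l) < s by rewrite subrr cabs0.
have W0 : W l != 0 by exact: cauchy_one_neq0.
pose Fn n w := F w * (w - l)^-1 ^+ n.
have cFn n : side_continuous l s (Fn n) by exact: side_continuous_cauchy.
(* These are the Taylor coefficients of f W at l. Since W does not vanish near l, they detect the
   order of f as well. *)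
pose c n := cauchy_int l s 1 (Fn n) l.
have step n k : cabs (k - l) < s / 2 ->
    cauchy_int l s 1 (Fn n) k = c n + (k - l) * cauchy_int l s 1 (Fn n.+1) k.
  move=> ks; have := cauchy_step s0 ks (cFn n).
  have -> : (fun w => Fn n w * (w - l)^-1) = Fn n.+1; last by [].
  by apply/funext => w; rewrite /Fn exprSr mulrA.
have F0 : Fn 0%N = F by apply/funext => w; rewrite /Fn expr0 mulr1.
have expand n k : (forall i, (i < n)%N -> c i = 0) -> cabs (k - l) < s / 2 ->
    f k * W k = (k - l) ^+ n * cauchy_int l s 1 (Fn n) k.
  move=> ci ks; elim: n ci => [|n IH] ci; first by rewrite expr0 mul1r F0 fF.
  rewrite IH => [|i iN]; last by apply: ci; exact: ltnW.
  by rewrite step // ci // add0r mulrA exprSr.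
have [ec|nc] := pselect (exists n, c n != 0).
  right; have [p cp min] := @ex_minnP (fun n => c n != 0) ec.
  exists p, (fun k => cauchy_int l s 1 (Fn p) k * (W k)^-1); split.
  - exact: (holo_at_mul (holo_at_cauchy s0 (cFn p)) (holo_at_inv hW W0)).
  - by rewrite mulf_neq0 // invr_eq0.
  apply: filterS2 nh (holo_at_neq0 hW W0) => k ks Wk.
  rewrite mulrA -(expand p k) ?mulfK // => i ip; apply/eqP.
  by apply: contraTT ip => /min; rewrite -leqNgt.
left; apply: filterS2 nh (holo_at_neq0 hW W0) => k ks Wk.
have c0 n : c n = 0 by apply/eqP; apply: contrapT => /negP cn; apply: nc;
  exists n.
have [K K0 FK] := side_continuous_bounded s0 cF.
(* After n steps the remainder carries |k - l|^n, and its data are at most K / s^n because the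
   contour stays at distance s from l. This yields the factor q^n with a constant independent of
   n. *)
pose q := cabs (k - l) / s.
have q0 : 0 <= q by rewrite divr_ge0 ?cabs_ge0 // ltW.
have q1 : q < 2^-1 by rewrite ltr_pdivrMr // mulrC.
have bound n : cabs (f k * W k) <= q ^+ n * (16 * s * (K * (2 / s))).
  rewrite (expand n) // cabsM cabsX.
  have -> : q ^+ n * (16 * s * (K * (2 / s))) =
      cabs (k - l) ^+ n * ((s ^+ n)^-1 * (16 * s * (K * (2 / s)))).
    by rewrite /q expr_div_n [RHS]mulrA.
  rewrite ler_wpM2l ?exprn_ge0 ?cabs_ge0 //.
  have -> : (s ^+ n)^-1 * (16 * s * (K * (2 / s))) =
      16 * s * (K * s^-1 ^+ n * (2 / s)) by rewrite -exprVn; ring.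
  have ks' : cabs (k - l) < s by move: ks s0; lra.
  have cc := side_continuous_cauchy 1 ks' (cFn n).
  apply: (le_cabs_sqint s0 cc).
  move=> w sw; rewrite expr1 /Fn 2!cabsM cabsX.
  have sw1 := on_square_cabs s0 sw.
  have sw2 := on_square_dist s0 sw ks.
  have s20 : 0 < s / 2 by rewrite divr_gt0.
  apply: ler_pM; rewrite ?mulr_ge0 ?exprn_ge0 ?cabs_ge0 //.
    apply: ler_pM; rewrite ?exprn_ge0 ?cabs_ge0 ?FK //.
    rewrite lerXn2r ?nnegrE ?cabs_ge0 ?invr_ge0 ?(ltW s0) //.
    by rewrite cabsV lef_pV2 ?posrE // (lt_le_trans s0).
  by rewrite cabsV -[2 / s]invf_div lef_pV2 ?posrE // (lt_le_trans s20).
have : cabs (f k * W k) = 0.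
  apply/eqP; rewrite eq_le cabs_ge0 andbT; apply: contraT; rewrite -ltNge =>
    gt0.
  pose C := 16 * s * (K * (2 / s)).
  have C0 : 0 < C by rewrite !mulr_gt0 ?invr_gt0.
  have : (fun n => q ^+ n) @ \oo --> (0 : R).
    by apply: cvg_expr; rewrite ger0_norm // (lt_trans q1) // invf_lt1 ?ltr1n.
  move=> /cvgrPdist_lt /(_ (cabs (f k * W k) / C)); rewrite divr_gt0 // =>
    /(_ isT).
  case=> n _ /(_ n (leqnn n)); rewrite sub0r normrN ger0_norm ?exprn_ge0 //.
  by rewrite ltr_pdivlMr // ltNge bound.
by move/eqP; rewrite cabs_eq0 mulf_eq0 (negbTE Wk) orbF => /eqP.
Qed.

End LocallyHolomorphic.

(** * Taylor expansion with iterated derivatives as coefficients *)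

Section TaylorExpansion.
Local Open Scope complex_scope.
Variable R : realType.
Implicit Types (f g : Cplx R -> Cplx R) (l z k : Cplx R).

Lemma holo_at_derive1n n f l : holo_at f l -> holo_at (derive1n n f) l.
Proof. by move=> hf; elim: n => [|n IH];
  [exact: hf|exact: (holo_at_derive1 IH)]. Qed.

(** At k = l this turns derivatives of the divided difference g into derivatives of f. It is stated
    on a neighbourhood so that the induction can differentiate it again. *)
Lemma derive1n_mul_subc f g (a : Cplx R) l n : holo_at g l ->
  (\forall k \near l, f k = a + (k - l) * g k) ->
  \forall k \near l, derive1n n.+1 f k =
    (k - l) * derive1n n.+1 g k + n.+1%:R * derive1n n g k.
Proof.
move=> hg fg.
have dmul h k : derivable h k 1 ->
    'D_1 ((fun k : Cplx R => k - l : Cplx R) * h) k =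
      (k - l) * derive1 h k + h k.
  move=> dh; have ds := @derivable_subc R l k.
  rewrite (deriveM ds dh) -derive1E.
  have dk : derivable (id : Cplx R -> Cplx R) k 1 by exact: derivable_id.
  have -> : 'D_1 (fun k : Cplx R => k - l : Cplx R) k = 1.
    have := deriveB dk (@derivable_const R l k).
    by rewrite derive_id derive_cst subr0.
  by rewrite /GRing.scale /= mulr1.
elim: n => [|n IH].
  apply: filterS2 (nbhs_interior fg) hg => k fgk dg.
  have := near_eq_derive (1 : Cplx R) fgk; rewrite -derive1E /= => ->.
  have dm : derivable ((fun k : Cplx R => k - l : Cplx R) * g) k 1.
    exact: (derivableM (@derivable_subc R l k) dg).
  have := deriveD (@derivable_const R a k) dm.
  by rewrite derive_cst add0r (dmul _ _ dg) mul1r => <-.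
apply: filterS3 (nbhs_interior IH) (holo_at_derive1n n.+1 hg)
  (holo_at_derive1n n hg) => k fgk d1 d0.
have E0 := near_eq_derive (1 : Cplx R) fgk.
rewrite -[LHS]/(derive1 (derive1n n.+1 f) k) derive1E E0.
have dm : derivable ((fun k : Cplx R => k - l : Cplx R) * (derive1n n.+1 g)) k
  1.
  exact: (derivableM (@derivable_subc R l k) d1).
have dZ : derivable (cst (n.+1%:R : Cplx R) * (derive1n n g)) k 1.
  exact: (derivableM (@derivable_const R n.+1%:R k) d0).
have e2 : 'D_1 (cst (n.+1%:R : Cplx R) * (derive1n n g)) k =
    n.+1%:R * derive1 (derive1n n g) k.
  rewrite (deriveM (@derivable_const R n.+1%:R k) d0) derive_cst scaler0 addr0.
  by rewrite -derive1E.
apply: (etrans (etrans (deriveD dm dZ) (congr2 +%R (dmul _ _ d1) e2))).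
rewrite -[derive1 (derive1n n.+1 g) k]/(derive1n n.+2 g k).
rewrite -[derive1 (derive1n n g) k]/(derive1n n.+1 g k).
move: (derive1n n.+2 g k) (derive1n n.+1 g k) => u v.
have -> : n.+2%:R = n.+1%:R + 1 :> R[i] by rewrite -(addn1 n.+1) natrD.
by move: (n.+1%:R : R[i]) => c; ring.
Qed.

(** h is the n-fold iterated divided difference. The coefficients are identified with derivatives
    because chains are defined through these. *)
Lemma holo_at_taylor f l n : holo_at f l ->
  exists2 h, holo_at h l & \forall k \near l,
    f k = \sum_(r < n) (k - l) ^+ r * ((r`!%:R)^-1 * derive1n r f l) +
          (k - l) ^+ n * h k.
Proof.
elim: n f => [|n IH] f hf.
  exists f => //; apply/nbhs_cabsP; exists 1 => // k _.
  by rewrite big_ord0 add0r mul1r.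
have [g hg fg] := holo_at_divided_difference hf.
have [h hh gh] := IH g hg; exists h => //.
apply: filterS2 (fg) gh => k -> ->.
have -> : f l = (0`!%:R)^-1 * derive1n 0 f l by rewrite fact0 invr1 mul1r.
rewrite big_ord_recl expr0 mul1r mulrDr addrA [in RHS]exprS mulrA;
  congr (_ + _ + _).
rewrite mulr_sumr; apply: eq_bigr => r _; rewrite lift0 mulrA exprS;
  congr (_ * _).
have /nbhs_singleton -> := derive1n_mul_subc r hg fg.
rewrite subrr mul0r add0r factS natrM invfM mulrACA mulVf ?mul1r //.
Qed.

End TaylorExpansion.

(** * Holomorphic matrix functions *)

Section HolomorphicMatrices.
Local Open Scope complex_scope.
Variable R : realType.
Implicit Types (f g : Cplx R -> Cplx R) (l z k : Cplx R).

Lemma near_forall_fin (I : finType) (P : I -> set (Cplx R)) l :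
  (forall i, \forall k \near l, P i k) -> \forall k \near l, forall i, P i k.
Proof.
move=> hP; suff h (s : seq I) : \forall k \near l, forall i, i \in s -> P i k.
  by apply: filterS (h (enum I)) => k hk i; apply: hk; rewrite mem_enum.
elim: s => [|i s IH].
  by apply/nbhs_cabsP; exists 1.
apply: filterS2 (hP i) IH => k hi hs j; rewrite in_cons => /orP[/eqP -> //|].
exact: hs.
Qed.

Definition mx_holo_at p q (A : Cplx R -> 'M[R[i]]_(p, q)) l :=
  forall i j, holo_at (fun k => A k i j) l.

Lemma mx_holo_at_derivable n (A : Cplx R -> 'M[R[i]]_n) l :
  mx_holo_at A l -> \forall k \near l, mx_derivable A k.
Proof.
move=> hA; apply: near_forall_fin => i; apply: near_forall_fin => j; exact: hA.
Qed.

Lemma mx_holo_at_cst p q (A : 'M[R[i]]_(p, q)) l : mx_holo_at (fun=> A) l.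
Proof. by move=> i j; exact: holo_at_cst. Qed.

Lemma mx_holo_at_add p q (A B : Cplx R -> 'M[R[i]]_(p, q)) l :
  mx_holo_at A l -> mx_holo_at B l -> mx_holo_at (fun k => A k + B k) l.
Proof.
move=> hA hB i j; have := holo_at_add (hA i j) (hB i j).
by apply: holo_at_eq; apply/nbhs_cabsP; exists 1 => // k _; rewrite mxE.
Qed.

Lemma mx_holo_at_scale p q f (A : Cplx R -> 'M[R[i]]_(p, q)) l :
  holo_at f l -> mx_holo_at A l -> mx_holo_at (fun k => f k *: A k) l.
Proof.
move=> hf hA i j; have := holo_at_mul hf (hA i j).
by apply: holo_at_eq; apply/nbhs_cabsP; exists 1 => // k _; rewrite mxE.
Qed.

Lemma mx_holo_at_mulmx p q r (A : Cplx R -> 'M[R[i]]_(p, q))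
    (B : Cplx R -> 'M[R[i]]_(q, r)) l :
  mx_holo_at A l -> mx_holo_at B l -> mx_holo_at (fun k => A k *m B k) l.
Proof.
move=> hA hB i j.
have := @holo_at_sum R _ (index_enum 'I_q) predT _ l
  (fun s _ => holo_at_mul (hA i s) (hB s j)).
by apply: holo_at_eq; apply/nbhs_cabsP; exists 1 => // k _; rewrite mxE.
Qed.

Lemma mx_holo_at_det n (A : Cplx R -> 'M[R[i]]_n) l :
  mx_holo_at A l -> holo_at (fun k => \det (A k)) l.
Proof.
move=> hA.
have hp (s : {perm 'I_n}) := @holo_at_prod R _ (index_enum 'I_n) predT
  (fun i k => A k i (s i)) l (fun i _ => hA i (s i)).
have := @holo_at_sum R _ (index_enum {perm 'I_n}) predT _ l
  (fun s _ => holo_at_mul (holo_at_cst ((-1) ^+ s) l) (hp s)).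
by apply: holo_at_eq; apply/nbhs_cabsP; exists 1.
Qed.

Lemma mx_holo_at_adj n (A : Cplx R -> 'M[R[i]]_n) l :
  mx_holo_at A l -> mx_holo_at (fun k => \adj (A k)) l.
Proof.
move=> hA i j.
have hM : mx_holo_at (fun k => row' j (col' i (A k))) l.
  move=> a b; apply: holo_at_eq (hA (lift j a) (lift i b)).
  by apply/nbhs_cabsP; exists 1 => // k _; rewrite !mxE.
have := holo_at_mul (holo_at_cst ((-1) ^+ (j + i)) l) (mx_holo_at_det hM).
by apply: holo_at_eq; apply/nbhs_cabsP; exists 1 => // k _; rewrite mxE.
Qed.

Lemma mx_dnbhs_eq p q (A B : Cplx R -> 'M[R[i]]_(p, q)) l :
  mx_holo_at A l -> mx_holo_at B l -> (\forall k \near l^', A k = B k) ->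
  A l = B l.
Proof.
move=> hA hB AB; apply/matrixP => i j.
apply: (dnbhs_eq (holo_at_derivable (hA i j)) (holo_at_derivable (hB i j))).
by apply: filterS AB => k ->.
Qed.

Lemma mx_holo_at_divided_difference p q (A : Cplx R -> 'M[R[i]]_(p, q)) l :
  mx_holo_at A l -> exists2 B : Cplx R -> 'M[R[i]]_(p, q), mx_holo_at B l &
    \forall k \near l, A k = A l + (k - l) *: B k.
Proof.
move=> hA.
have G ij : {g | holo_at g l /\ \forall k \near l, A k ij.1 ij.2 =
  A l ij.1 ij.2 + (k - l) * g k}.
  by apply: cid; have [g] := holo_at_divided_difference (hA ij.1 ij.2);
    exists g.
exists (fun k => \matrix_(i, j) sval (G (i, j)) k).
  move=> i j; have [h _] := svalP (G (i, j)); apply: holo_at_eq h.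
  by apply/nbhs_cabsP; exists 1 => // k _; rewrite mxE.
have h : \forall k \near l, forall i j, A k i j =
  A l i j + (k - l) * sval (G (i, j)) k.
  apply: near_forall_fin => i; apply: near_forall_fin => j.
  by have [] := svalP (G (i, j)).
by apply: filterS h => k h; apply/matrixP => i j; rewrite !mxE h.
Qed.

Lemma mx_holo_at_taylor n (A : Cplx R -> 'M[R[i]]_n) l L :
  mx_holo_at A l -> exists2 H : Cplx R -> 'M[R[i]]_n, mx_holo_at H l &
    \forall k \near l, A k = \sum_(r < L) (k - l) ^+ r *:
        ((r`!%:R)^-1 *: mx_derive r A l) + (k - l) ^+ L *: H k.
Proof.
move=> hA.
have G ij : {h | holo_at h l /\ \forall k \near l, A k ij.1 ij.2 =
   \sum_(r < L) (k - l) ^+ r *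
     ((r`!%:R)^-1 * derive1n r (fun k => A k ij.1 ij.2 : Cplx R) l)
     + (k - l) ^+ L * h k}.
  by apply: cid; have [g] := holo_at_taylor L (hA ij.1 ij.2); exists g.
exists (fun k => \matrix_(i, j) sval (G (i, j)) k).
  move=> i j; have [h _] := svalP (G (i, j)); apply: holo_at_eq h.
  by apply/nbhs_cabsP; exists 1 => // k _; rewrite mxE.
have h : \forall k \near l, forall i j, A k i j = \sum_(r < L) (k - l) ^+ r *
    ((r`!%:R)^-1 * derive1n r (fun k => A k i j : Cplx R) l)
     + (k - l) ^+ L * sval (G (i, j)) k.
  apply: near_forall_fin => i; apply: near_forall_fin => j.
  by have [] := svalP (G (i, j)).
apply: filterS h => k h; apply/matrixP => i j; rewrite !mxE h summxE.
by congr (_ + _); apply: eq_bigr => r _; rewrite !mxE.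
Qed.

(** Meant for the numerator Q of the inverse, whose coefficients beyond the first never have to be
    recognized as derivatives. *)
Lemma mx_holo_at_expand p q (A : Cplx R -> 'M[R[i]]_(p, q)) l L :
  mx_holo_at A l -> exists (c : nat -> 'M[R[i]]_(p, q))
    (H : Cplx R -> 'M[R[i]]_(p, q)),
   [/\ mx_holo_at H l, (0 < L)%N -> c 0%N = A l &
    \forall k \near l, A k = \sum_(r < L) (k - l) ^+ r *: c r + (k - l) ^+ L *:
      H k].
Proof.
elim: L A => [|L IH] A hA.
  exists (fun=> 0), A; split => //; apply/nbhs_cabsP; exists 1 => // k _.
  by rewrite big_ord0 add0r scale1r.
have [B hB AB] := mx_holo_at_divided_difference hA.
have [c [H [hH _ BH]]] := IH B hB.
exists (fun r => if r is r'.+1 then c r' else A l), H; split;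
  [exact: hH|by []|].
apply: filterS2 AB BH => k -> ->.
rewrite big_ord_recl expr0 scale1r -addrA; congr (_ + _).
rewrite scalerDr scaler_sumr scalerA -exprS; congr (_ + _).
by apply: eq_bigr => r _; rewrite scalerA -exprS lift0.
Qed.

(** Letting k tend to l kills the first coefficient; off l one may then divide by k - l and
    repeat. *)
Lemma mx_taylor_unique p q (c : nat -> 'M[R[i]]_(p, q))
  (e : Cplx R -> 'M[R[i]]_(p, q)) l L :
  mx_holo_at e l ->
  (\forall k \near l^', \sum_(r < L) (k - l) ^+ r *: c r = (k - l) ^+ L *: e k)
    ->
  forall r, (r < L)%N -> c r = 0.
Proof.
move=> he; elim: L c => [|L IH] c hc r; first by [].
have c0 : c 0%N = 0.
  have hsum : mx_holo_at (fun k => c 0%N + (k - l) *: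
      \sum_(r < L) (k - l) ^+ r *: c r.+1) l.
    apply: mx_holo_at_add; first exact: mx_holo_at_cst.
    apply: mx_holo_at_scale; first exact: holo_at_subc.
    move=> i j; have := @holo_at_sum R _ (index_enum 'I_L) predT _ l (fun r _ =>
      holo_at_mul (holo_at_exp r (holo_at_subc l l))
        (holo_at_cst (c r.+1 i j) l)).
    apply: holo_at_eq; apply/nbhs_cabsP; exists 1 => // k _; rewrite summxE.
    by apply: eq_bigr => s _; rewrite mxE.
  have he' := mx_holo_at_scale (holo_at_exp L.+1 (holo_at_subc l l)) he.
  have := mx_dnbhs_eq hsum he'; rewrite subrr scale0r addr0 exprS mul0r scale0r;
    apply.
  apply: filterS hc => k <-; rewrite big_ord_recl expr0 scale1r scaler_sumr.
  by congr (_ + _); apply: eq_bigr => s _; rewrite scalerA -exprS lift0.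
case: r => [//|r]; rewrite ltnS => rL; apply: (IH (fun r => c r.+1)) => //.
move: hc => /dnbhs_cabsP[d d0 hc]; apply/dnbhs_cabsP; exists d => // k kl kd.
have kl0 : k - l != 0 by rewrite subr_eq0.
apply: (scalerI kl0); have := hc k kl kd; rewrite scalerA -exprS => <-.
rewrite big_ord_recl c0 scaler0 add0r scaler_sumr.
by apply: eq_bigr => s _; rewrite scalerA -exprS lift0.
Qed.

(** A Cauchy product whose coefficient of (k - l)^j is the left side of the j-th chain equation. The
    induction removes v 0 and factors k - l out of the other terms, so only A times v 0 needs the
    expansion of A. *)
Lemma mulmx_taylor n (A : Cplx R -> 'M[R[i]]_n) (a : nat -> 'M[R[i]]_n) l :
  mx_holo_at A l ->
  (forall L, exists2 H : Cplx R -> 'M[R[i]]_n, mx_holo_at H l &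
    \forall k \near l, A k = \sum_(r < L) (k - l) ^+ r *: a r + (k - l) ^+ L *:
      H k) ->
  forall L (v : nat -> 'cV[R[i]]_n), exists2 E : Cplx R -> 'cV[R[i]]_n,
    mx_holo_at E l &
    \forall k \near l, A k *m (\sum_(s < L) (k - l) ^+ s *: v s) =
      \sum_(j < L) (k - l) ^+ j *: (\sum_(s < j.+1) a (j - s)%N *m v s) +
      (k - l) ^+ L *: E k.
Proof.
move=> hA hT; elim=> [|L IH] v.
  exists (fun=> 0); first exact: mx_holo_at_cst.
  by apply/nbhs_cabsP; exists 1 => // k _;
    rewrite !big_ord0 mulmx0 scaler0 addr0.
have [E hE EE] := IH (fun s => v s.+1); have [H hH AH] := hT L.+1.
exists (fun k => H k *m v 0%N + E k).
  exact: (mx_holo_at_add (mx_holo_at_mulmx hH (mx_holo_at_cst (v 0%N) l)) hE).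
apply: filterS2 EE AH => k EE AH.
have -> : \sum_(s < L.+1) (k - l) ^+ s *: v s =
    v 0%N + (k - l) *: \sum_(s < L) (k - l) ^+ s *: v s.+1.
  rewrite big_ord_recl expr0 scale1r scaler_sumr; congr (_ + _).
  by apply: eq_bigr => s _; rewrite scalerA -exprS lift0.
have E0 : A k *m v 0%N = (\sum_(r < L.+1) (k - l) ^+ r *: a r) *m v 0%N +
    (k - l) ^+ L.+1 *: (H k *m v 0%N).
  by rewrite AH mulmxDl -scalemxAl.
have -> : \sum_(j < L.+1) (k - l) ^+ j *: (\sum_(s < j.+1) a (j - s)%N *m v s) =
    (\sum_(r < L.+1) (k - l) ^+ r *: a r) *m v 0%N + (k - l) *:
      \sum_(j < L) (k - l) ^+ j *: (\sum_(s < j.+1) a (j - s)%N *m v s.+1).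
  transitivity (\sum_(j < L.+1) ((k - l) ^+ j *: (a j *m v 0%N) +
      (k - l) ^+ j *: \sum_(s < j) a (j - s.+1)%N *m v s.+1)).
    apply: eq_bigr => j _; rewrite -scalerDr big_ord_recl subn0;
      congr (_ *: (_ + _)).
  rewrite big_split /= mulmx_suml; congr (_ + _).
    by apply: eq_bigr => j _; rewrite scalemxAl.
  rewrite big_ord_recl big_ord0 scaler0 add0r scaler_sumr.
  apply: eq_bigr => j _; rewrite lift0 exprS -scalerA; congr (_ *: (_ *: _)).
by rewrite mulmxDr -scalemxAr EE E0 !scalerDr scalerA -exprS addrACA.
Qed.

End HolomorphicMatrices.

(** * The pole of the inverse and chains *)

Section PoleOfInverse.
Local Open Scope complex_scope.
Variable R : realType.
Implicit Types (f g : Cplx R -> Cplx R) (l z k : Cplx R) (D : set (Cplx R)).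

Lemma holo_at_open D (P : set (Cplx R)) z : open D -> D z ->
  (forall k, D k -> P k) ->
  \forall k \near z, P k.
Proof.
move=> oD Dz DP; have nD : nbhs z D by exact: (open_nbhs_nbhs (conj oD Dz)).
exact: (filterS DP nD).
Qed.

(** The points of D near which f vanishes identically form a relatively open set. It is relatively
    closed too: at any other point f has finite order, so it has no zeros in a punctured
    neighbourhood. If l belonged to it, it would be all of D. *)
Lemma holo_connected_order D f l : open D -> connected D ->
  (forall z, D z -> derivable f z 1) -> (exists k, D k /\ f k != 0) -> D l ->
  exists p g, [/\ holo_at g l, g l != 0 & \forall k \near l, f k =
    (k - l) ^+ p * g k].
Proof.
move=> oD cD df [k0 [Dk0 fk0]] Dl.
have hf z : D z -> holo_at f z by move=> Dz; exact: holo_at_open oD Dz df.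
have [fl0|//] := holo_at_order (hf l Dl); exfalso.
pose C : set (Cplx R) := interior [set k | f k = 0].
suff DC : D `&` C = D.
  move: Dk0; rewrite -{1}DC => -[_ /nbhs_singleton /= fk].
  by rewrite fk eqxx in fk0.
apply: cD; first by exists l.
  by exists C => //; exact: open_interior.
(* A closed set whose trace on D is [C], provided that D minus [C] is open. *)
exists (~` interior (D `\` C)).
  by apply: open_closedC; exact: open_interior.
apply/seteqP; split=> k [Dk Ck]; split; try exact: Dk.
  by move=> /interior_subset[].
apply: contrapT => nCk; apply: Ck.
have [//|[p [g [hg gk fg]]]] := holo_at_order (hf k Dk).
have nD : nbhs k D by exact: (open_nbhs_nbhs (conj oD Dk)).
apply: filterS3 fg (holo_at_neq0 hg gk) nD => k' fk' gk' Dk'; split;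
  first exact: Dk'.
have [-> //|kk'] := eqVneq k' k.
move=> /nbhs_singleton /=; rewrite fk' => /eqP.
by rewrite mulf_eq0 (negbTE gk') orbF expf_eq0 subr_eq0 (negbTE kk') andbF.
Qed.

Lemma dnbhs_near l (P : set (Cplx R)) :
  (\forall k \near l, P k) -> \forall k \near l^', P k.
Proof. by move=> /nbhs_cabsP[e e0 h]; apply/dnbhs_cabsP; exists e => // k _;
  exact: h. Qed.

Lemma dnbhs_neq l : \forall k \near l^', k - l != 0.
Proof. by apply/dnbhs_cabsP; exists 1 => // k kl _; rewrite subr_eq0. Qed.

(** The order p of the determinant need not be that of the pole, since the adjugate may vanish at l
    as well. Common factors k - l are cancelled until the numerator is nonzero at l. *)
Lemma invmx_pole n D (A : Cplx R -> 'M[R[i]]_n) l :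
  open D -> connected D -> mx_holomorphic D A ->
  (exists k, D k /\ A k \in unitmx) -> D l -> A l \notin unitmx ->
  exists m (Q : Cplx R -> 'M[R[i]]_n), [/\ (0 < m)%N, mx_holo_at Q l, Q l != 0 &
    \forall k \near l^', A k \in unitmx /\ invmx (A k) = (k - l) ^- m *: Q k].
Proof.
move=> oD cD hA [k0 [Dk0 uk0]] Dl nu.
have hAz z : D z -> mx_holo_at A z.
  by move=> Dz i j; apply: (holo_at_open oD Dz) => k Dk; exact: hA.
have hAl := hAz l Dl.
have [p [g [hg gl dg]]] : exists p g, [/\ holo_at g l, g l != 0 &
    \forall k \near l, (\det (A k) : Cplx R) = (k - l) ^+ p * g k].
  apply: (@holo_connected_order D (fun k => \det (A k) : Cplx R)) => //.
    by move=> z Dz; apply: holo_at_derivable; exact: mx_holo_at_det (hAz z Dz).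
  by exists k0; split => //; rewrite unitmxE unitfE in uk0.
have unear : \forall k \near l^', A k \in unitmx.
  apply: filterS3 (dnbhs_neq l) (dnbhs_near dg)
    (dnbhs_near (holo_at_neq0 hg gl)).
  by move=> k kl dk gk; rewrite unitmxE unitfE dk mulf_neq0 // expf_neq0.
pose Q0 k := (g k)^-1 *: \adj (A k).
have iQ0 : \forall k \near l^', invmx (A k) = (k - l) ^- p *: Q0 k.
  apply: filterS2 unear (dnbhs_near dg) => k uk dk.
  by rewrite /invmx uk dk scalerA -invfM.
have hQ0 : mx_holo_at Q0 l.
  exact: (mx_holo_at_scale (holo_at_inv hg gl) (mx_holo_at_adj hAl)).
move: (Q0) hQ0 iQ0 => {Q0} Q.
elim: p Q {dg} => [|p IH] Q hQ iQ.
  (* If everything cancelled, the inverse would extend holomorphically to l, and A(l) Q(l) = 1 would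
     contradict singularity. This gives m >= 1. *)
  exfalso; move/negP: nu; apply.
  have hAQ := mx_holo_at_mulmx hAl hQ.
  have : A l *m Q l = 1%:M.
    apply: (mx_dnbhs_eq hAQ (mx_holo_at_cst 1%:M l)).
    apply: filterS2 unear iQ => k uk; rewrite expr0 invr1 scale1r => <-.
    exact: mulmxV.
  by case/mulmx1_unit.
have [Ql|Ql] := eqVneq (Q l) 0; last first.
  by exists p.+1, Q; split => //; apply: filterS2 unear iQ => k.
have [Q1 hQ1 QE] := mx_holo_at_divided_difference hQ.
apply: (IH Q1 hQ1).
apply: filterS3 (dnbhs_neq l) (dnbhs_near QE) iQ => k kl QE' ->.
by rewrite QE' Ql add0r scalerA exprSr invfM -mulrA mulVf // mulr1.
Qed.

Lemma inverse_expansion_pole n (A : Cplx R -> 'M[R[i]]_n) l m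
  (Q : Cplx R -> 'M[R[i]]_n) :
  (0 < m)%N -> mx_holo_at Q l ->
  (\forall k \near l^', A k \in unitmx /\ invmx (A k) = (k - l) ^- m *: Q k) ->
  exists2 P, inverse_expansion A l m P & P m = Q l.
Proof.
move=> m0 hQ iQ; have [c [H [hH c0 QE]]] := mx_holo_at_expand m hQ.
(* Coefficient c r of Q accompanies (k - l)^(r - m), so r = m - j gives the power -j; the Taylor
   remainder of order m becomes the holomorphic part. *)
exists (fun j => c (m - j)%N); last by rewrite subnn c0.
exists H; split; first exact: mx_holo_at_derivable.
apply: filterS3 (dnbhs_neq l) (dnbhs_near QE) iQ => k kl QEk [uk ->]; split =>
  //.
have hn i : (k - l) ^+ i != 0 by rewrite expf_neq0.
rewrite QEk scalerDr scalerA mulVf // scale1r; congr (_ + _).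
rewrite scaler_sumr big_add1 /= big_mkord (reindex_inj rev_ord_inj) /=.
apply: eq_bigr => r _; rewrite scalerA; congr (_ *: c _).
have {1}-> : m = ((m - r.+1) + r.+1)%N by rewrite subnK.
by rewrite exprD invfM mulrAC mulVf // mul1r.
Qed.

Section Chains.
Variables (n : nat) (A : Cplx R -> 'M[R[i]]_n) (l : Cplx R).
Hypothesis hA : mx_holo_at A l.
Let a r : 'M[R[i]]_n := (r`!%:R)^-1 *: mx_derive r A l.

Let aT L : exists2 H : Cplx R -> 'M[R[i]]_n, mx_holo_at H l &
  \forall k \near l, A k = \sum_(r < L) (k - l) ^+ r *: a r + (k - l) ^+ L *: H
    k.
Proof. exact: mx_holo_at_taylor. Qed.

(** The equations without the nonvanishing condition, for sequences indexed by [nat], so that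
    vectors can be shifted and repaired afterwards. *)
Definition chain_eqs L (v : nat -> 'cV[R[i]]_n) :=
  forall j, (j < L)%N -> \sum_(s < j.+1) a (j - s)%N *m v s = 0.

Lemma is_chainP L (v : nat -> 'cV[R[i]]_n) :
  is_chain A l (fun i : 'I_L => v i) <->
  (forall j, (j < L)%N -> v j != 0) /\ chain_eqs L v.
Proof.
have E j : (j < L)%N -> \sum_(s < j.+1) a (j - s)%N *m v s =
    \sum_(s < L | (s <= j)%N) ((j - s)`!%:R)^-1 *:
      (mx_derive (j - s) A l *m v s).
  move=> jL; rewrite (big_ord_widen L (fun s => a (j - s)%N *m v s)) //.
  by apply: eq_bigr => s _; rewrite /a scalemxAl.
split=> -[h1 h2]; split.
- by move=> j jL; exact: (h1 (Ordinal jL)).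
- by move=> j jL; rewrite E //; exact: (h2 (Ordinal jL)).
- by move=> j; exact: h1.
- by move=> j; rewrite -E //; exact: h2.
Qed.

(* Adding to a chain a delayed copy of itself gives a chain; this makes every
   vector nonzero once the first one is. *)
Lemma chain_eqs_shift L t v : chain_eqs L v ->
  chain_eqs L (fun s => v s + (if (t <= s)%N then v (s - t)%N else 0)).
Proof.
move=> hv j jL.
under eq_bigr do rewrite mulmxDr; rewrite big_split /= (hv j jL) add0r.
have [jt|tj] := ltnP j t.
  apply: big1 => s _; rewrite ifN ?mulmx0 // -ltnNge.
  by apply: leq_trans jt; rewrite ltn_ord.
have -> : j.+1 = (t + (j - t).+1)%N by rewrite addnS subnKC.
rewrite big_split_ord /= big1 ?add0r => [|s _]; last first.
  by rewrite ifN ?mulmx0 // -ltnNge.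
rewrite -[RHS](hv (j - t)%N (leq_ltn_trans (leq_subr _ _) jL)).
by apply: eq_bigr => s _; rewrite leq_addr addKn subnDA.
Qed.

Lemma chain_eqs_neq0 L v : chain_eqs L v -> v 0%N != 0 -> has_chain A l L.
Proof.
move=> hv v0.
suff [u [hu u0 uj]] : exists u, [/\ chain_eqs L u, u 0%N != 0 &
    forall j, (j < L)%N -> u j != 0].
  by exists (fun i => u i); apply/is_chainP.
suff h t : exists u, [/\ chain_eqs L u, u 0%N != 0 &
    forall j, (j < t)%N -> u j != 0] by exact: h.
elim: t => [|t [u [hu u0 ut]]]; first by exists v.
have [utt|utt] := eqVneq (u t) 0; last first.
  exists u; split => // j; rewrite ltnS leq_eqVlt => /orP[/eqP -> //|].
  exact: ut.
have t0 : (0 < t)%N by case: t utt {ut} => // e; rewrite e eqxx in u0.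
(* A delay of t leaves the vectors before index t untouched and replaces the zero vector u t by u
   0. *)
exists (fun s => u s + (if (t <= s)%N then u (s - t)%N else 0)); split.
- exact: chain_eqs_shift.
- by rewrite leqNgt t0 addr0.
- move=> j; rewrite ltnS leq_eqVlt => /orP[/eqP ->|jt].
    by rewrite leqnn utt add0r subnn.
  by rewrite leqNgt jt addr0; exact: ut.
Qed.

Lemma longest_chain_pole m (Q : Cplx R -> 'M[R[i]]_n) : (0 < m)%N ->
  mx_holo_at Q l -> Q l != 0 ->
  (\forall k \near l^', A k \in unitmx /\ invmx (A k) = (k - l) ^- m *: Q k) ->
  longest_chain A l m.
Proof.
move=> m0 hQ Ql iQ; split.
  have [j Qj] : exists j, col j (Q l) != 0.
    apply: contrapT => nj; move/eqP: Ql; apply; apply/matrixP => i j.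
    have [/colP/(_ i)|Qj] := eqVneq (col j (Q l)) 0; first by rewrite !mxE.
    by case: nj; exists j.
  pose w : 'cV[R[i]]_n := delta_mx j 0.
  have [c [H [hH c0 QE]]] := mx_holo_at_expand m hQ.
  pose v s := c s *m w.
  apply: (@chain_eqs_neq0 m v); last by rewrite /v c0 // -colE.
  have [E hE AE] := mulmx_taylor hA aT m v.
  (* Since A Q = (k - l)^m, applying A to the truncation of Q w gives (k - l)^m (w - A H w).
     Comparison with the Cauchy product writes its first m terms as (k - l)^m times this function,
     so uniqueness yields the chain equations. *)
  have he : mx_holo_at (fun k => w + (-1) *: (A k *m (H k *m w)) + (-1) *: E k)
    l.
    have hHw := mx_holo_at_mulmx hH (mx_holo_at_cst w l).
    have h1 := mx_holo_at_scale (holo_at_cst (-1) l) (mx_holo_at_mulmx hA hHw).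
    have h2 := mx_holo_at_scale (holo_at_cst (-1) l) hE.
    exact: (mx_holo_at_add (mx_holo_at_add (mx_holo_at_cst w l) h1) h2).
  apply: (@mx_taylor_unique _ _ _ (fun j => \sum_(s < j.+1) a (j - s)%N *m v s)
    _ _ _ he).
  have h : \forall k \near l^',
      Q k = \sum_(r < m) (k - l) ^+ r *: c r + (k - l) ^+ m *: H k /\
      A k *m (\sum_(s < m) (k - l) ^+ s *: v s) =
        \sum_(j < m) (k - l) ^+ j *: (\sum_(s < j.+1) a (j - s)%N *m v s) +
        (k - l) ^+ m *: E k.
    by apply: filterS2 (dnbhs_near QE) (dnbhs_near AE) => k.
  apply: filterS3 (dnbhs_neq l) h iQ => k kl [QEk AEk] [uk ik].
  have kn : (k - l) ^+ m != 0 by rewrite expf_neq0.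
  have AQ : A k *m Q k = (k - l) ^+ m *: 1%:M.
    rewrite -(mulmxV uk) ik -!scalemxAr scalerA mulfV // scale1r //.
  have sv : \sum_(s < m) (k - l) ^+ s *: v s =
    Q k *m w - (k - l) ^+ m *: (H k *m w).
    rewrite {1}QEk mulmxDl -scalemxAl addrK mulmx_suml.
    by apply: eq_bigr => s _; rewrite scalemxAl.
  move: AEk; rewrite sv mulmxBr (mulmxA (A k) (Q k) w) AQ -scalemxAl mul1mx
    -scalemxAr => AEk.
  apply: (addIr ((k - l) ^+ m *: E k)); rewrite -AEk.
  move: (A k *m (H k *m w)) (E k) ((k - l) ^+ m) => x e y.
  by rewrite !scalerDr !scaleN1r !scalerN addrNK.
move=> L [v0 hv0].
have [->//|L0] := posnP L.
(* [inord] needs a nonempty index type; the values it produces beyond L are harmless. *)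
case: L L0 v0 hv0 => [//|L] _ v0 hv0.
pose v (s : nat) := v0 (inord s).
have vE : v0 = (fun i : 'I_L.+1 => v i) by apply/funext => i;
  rewrite /v inord_val.
rewrite vE in hv0; have [vn ev] := (is_chainP L.+1 v).1 hv0.
(* Were the length L + 1 larger than m, then V = A^-1 (k - l)^(L+1) E = (k - l)^(L+1-m) Q E would
   vanish at l, whereas V(l) = v 0 is nonzero. *)
rewrite leqNgt; apply/negP => mL.
have [E hE AE] := mulmx_taylor hA aT L.+1 v.
have hV : mx_holo_at (fun k => \sum_(s < L.+1) (k - l) ^+ s *: v s) l.
  move=> i j; have := @holo_at_sum R _ (index_enum 'I_L.+1) predT _ l
    (fun s _ =>
    holo_at_mul (holo_at_exp s (holo_at_subc l l)) (holo_at_cst (v s i j) l)).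
  apply: holo_at_eq; apply/nbhs_cabsP; exists 1 => // k _; rewrite summxE.
  by apply: eq_bigr => s _; rewrite mxE.
have hQE := mx_holo_at_scale (holo_at_exp (L.+1 - m) (holo_at_subc l l))
  (mx_holo_at_mulmx hQ hE).
have := mx_dnbhs_eq hV hQE.
rewrite big_ord_recl expr0 scale1r big1 ?addr0; last first.
  by move=> i _; rewrite subrr expr0n lift0 scale0r.
rewrite subrr expr0n subn_eq0 leqNgt mL scale0r => v00.
have := vn 0%N isT; rewrite v00 ?eqxx //.
apply: filterS3 (dnbhs_neq l) (dnbhs_near AE) iQ => k kl AEk [uk ik].
have kn i : (k - l) ^+ i != 0 by rewrite expf_neq0.
rewrite -[LHS](mulKmx uk) AEk big1 => [|j _]; last by rewrite ev ?scaler0.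
rewrite add0r ik -scalemxAr -scalemxAl scalerA; congr (_ *: _).
by rewrite -{1}(subnK (ltnW mL)) exprD mulfK.
Qed.

End Chains.

End PoleOfInverse.

(** * The spectral norm *)

Section SpectralNorm.
Local Open Scope sesquilinear_scope.
Local Open Scope complex_scope.
Variables (R : realType) (n : nat).
Implicit Types (X Y : 'M[R[i]]_n) (u v : 'cV[R[i]]_n).

Definition vnorm v : R := Num.sqrt (\sum_i cabs (v i 0) ^+ 2).

Lemma sum_cabs_ge0 v : 0 <= \sum_i cabs (v i 0) ^+ 2.
Proof. by apply: sumr_ge0 => i _; exact: sqr_ge0. Qed.

Lemma vnorm_ge0 v : 0 <= vnorm v. Proof. exact: sqrtr_ge0. Qed.

Lemma sqr_vnorm v : vnorm v ^+ 2 = \sum_i cabs (v i 0) ^+ 2.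
Proof. by rewrite sqr_sqrtr // sum_cabs_ge0. Qed.

Lemma le_cabs_vnorm v i : cabs (v i 0) <= vnorm v.
Proof.
rewrite -(ler_pXn2r (_ : 0 < 2)%N) ?nnegrE ?cabs_ge0 ?vnorm_ge0 // sqr_vnorm.
by rewrite (bigD1 i) //= lerDl sumr_ge0 // => j _; exact: sqr_ge0.
Qed.

Lemma vnorm_eq0 v : (vnorm v == 0) = (v == 0).
Proof.
apply/eqP/eqP => [v0|->].
  apply/colP => i; apply/eqP; rewrite mxE -cabs_eq0 eq_le cabs_ge0 andbT -v0.
  exact: le_cabs_vnorm.
by rewrite /vnorm big1 ?sqrtr0 // => i _; rewrite mxE cabs0 expr0n.
Qed.

Lemma vnorm_gt0 v : (0 < vnorm v) = (v != 0).
Proof. by rewrite lt_def vnorm_ge0 andbT vnorm_eq0. Qed.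

Lemma vnormZ (c : R[i]) v : vnorm (c *: v) = cabs c * vnorm v.
Proof.
rewrite /vnorm; under eq_bigr do rewrite mxE cabsM exprMn.
by rewrite -mulr_sumr sqrtrM ?sqr_ge0 // sqrtr_sqr ger0_norm // cabs_ge0.
Qed.

(** With a and b the two norms, (x + y)^2 <= (a + b) / a x^2 + (a + b) / b y^2, the difference being
    (b x - a y)^2 / (a b). Summed over the entries, the right side is exactly (a + b)^2. *)
Lemma le_vnormD u v : vnorm (u + v) <= vnorm u + vnorm v.
Proof.
have [->|u0] := eqVneq u 0.
  by rewrite add0r lerDr vnorm_ge0.
have [->|v0] := eqVneq v 0.
  by rewrite addr0 lerDl vnorm_ge0.
have a0 : 0 < vnorm u by rewrite vnorm_gt0.
have b0 : 0 < vnorm v by rewrite vnorm_gt0.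
rewrite -(ler_pXn2r (_ : 0 < 2)%N) ?nnegrE ?addr_ge0 ?vnorm_ge0 // sqr_vnorm.
set a := vnorm u in a0 *; set b := vnorm v in b0 *.
apply: (@le_trans _ _ (\sum_i ((a + b) / a * cabs (u i 0) ^+ 2 +
   (a + b) / b * cabs (v i 0) ^+ 2))).
  apply: ler_sum => i _; rewrite mxE.
  have := le_cabsD (u i 0) (v i 0); have := cabs_ge0 (u i 0 + v i 0).
  move: (cabs (u i 0 + v i 0)) (cabs (u i 0)) (cabs (v i 0)) => z x y z0 zxy.
  apply: (@le_trans _ _ ((x + y) ^+ 2)).
    by rewrite lerXn2r ?nnegrE // (le_trans z0).
  rewrite -subr_ge0.
  have -> : (a + b) / a * x ^+ 2 + (a + b) / b * y ^+ 2 - (x + y) ^+ 2 =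
     (b * x - a * y) ^+ 2 / (a * b) by field; rewrite !gt_eqF.
  by rewrite divr_ge0 ?sqr_ge0 // mulr_ge0 // ltW.
rewrite big_split /= -!mulr_sumr -!sqr_vnorm -/a -/b.
rewrite le_eqVlt; apply/orP; left; apply/eqP; field; rewrite !gt_eqF //.
Qed.

Lemma form_vnorm v : (v^t* *m v) 0 0 = (vnorm v ^+ 2)%:C.
Proof.
rewrite mxE sqr_vnorm rmorph_sum; apply: eq_bigr => i _.
by rewrite !mxE mulrC -normCK norm_cabs rmorphXn.
Qed.

Lemma form_diag (d : 'rV[R[i]]_n) v :
  (v^t* *m diag_mx d *m v) 0 0 = \sum_i d 0 i * ((cabs (v i 0) ^+ 2)%:C).
Proof.
rewrite -mulmxA mxE; apply: eq_bigr => i _.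
rewrite mul_diag_mx !mxE mulrCA; congr (_ * _).
by rewrite mulrC -normCK norm_cabs rmorphXn.
Qed.

Lemma gram_spectral X : exists P : 'M[R[i]]_n,
  [/\ P *m P^t* = 1%:M, P^t* *m P = 1%:M &
   X^t* *m X = P^t* *m diag_mx (spectral_diag (X^t* *m X)) *m P].
Proof.
pose N := X^t* *m X.
have Nh : N \is hermsymmx.
  by apply/is_hermitianmxP; rewrite expr0 scale1r /N trmx_mul map_mxM trmxCK.
have /hermitian_normalmx /orthomx_spectralP Ne := Nh.
have PU : spectralmx N \is unitarymx by exact: spectral_unitarymx.
have PPt : spectralmx N *m (spectralmx N)^t* = 1%:M by apply/unitarymxP.
exists (spectralmx N); split => //; first by apply/mulmx1C.
by rewrite -/N {1}Ne invmx_unitary.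
Qed.

(** The link between singular values, defined by diagonalizing the Gram matrix, and the action of X
    on vectors. It makes the spectral norm the operator norm, from which homogeneity and
    subadditivity follow. *)
Lemma vnorm_mulmx_spectral X : exists P : 'M[R[i]]_n,
  [/\ P *m P^t* = 1%:M, forall v, vnorm (P *m v) = vnorm v,
   forall i, spectral_diag (X^t* *m X) 0 i = (singular_value X i ^+ 2)%:C &
   forall v, vnorm (X *m v) ^+ 2 =
     \sum_i singular_value X i ^+ 2 * cabs ((P *m v) i 0) ^+ 2].
Proof.
have [P [PPt PtP XE]] := gram_spectral X; set d := spectral_diag _ in XE *.
have Pv v : vnorm (P *m v) = vnorm v.
  apply/eqP; rewrite -(eqrXn2 (_ : 0 < 2)%N) ?vnorm_ge0 //; apply/eqP/complexI.
  by rewrite -!form_vnorm trmx_mul map_mxM -mulmxA (mulmxA _ P) PtP mul1mx.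
have Xv v : (vnorm (X *m v) ^+ 2)%:C =
  \sum_i d 0 i * ((cabs ((P *m v) i 0) ^+ 2)%:C).
  rewrite -form_vnorm -form_diag !trmx_mul !map_mxM -!mulmxA.
  by rewrite (mulmxA (X^t* )) XE !mulmxA.
(* Testing on the i-th eigenvector shows that d i is a squared norm, so nothing is lost by the real
   part and the square root in [singular_value]. *)
have dE i : d 0 i = (singular_value X i ^+ 2)%:C.
  have := Xv (P^t* *m delta_mx i 0).
  rewrite (mulmxA P) PPt mul1mx (bigD1 i) //= big1 ?addr0 => [|j ji];
    last first.
    by rewrite mxE (negbTE ji) cabs0 expr0n mulr0.
  rewrite mxE !eqxx cabs1 expr1n mulr1 => dE.
  rewrite /singular_value -/d -dE; congr (_%:C); apply/esym/sqr_sqrtr.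
  exact: sqr_ge0.
exists P; split => // v; apply: complexI; rewrite Xv rmorph_sum.
by apply: eq_bigr => i _; rewrite dE -(rmorphM (real_complex R)).
Qed.

Lemma singular_value_ge0 X i : 0 <= singular_value X i.
Proof. exact: sqrtr_ge0. Qed.

Lemma spectral_norm_ge0 X : 0 <= spectral_norm X.
Proof.
rewrite /spectral_norm; elim/big_ind: _ => // [x y x0 y0|i _].
  by rewrite le_max x0.
exact: singular_value_ge0.
Qed.

Lemma vnorm_mulmx_le X v : vnorm (X *m v) <= spectral_norm X * vnorm v.
Proof.
have [P [_ Pv _ Xv]] := vnorm_mulmx_spectral X.
rewrite -(ler_pXn2r (_ : 0 < 2)%N) ?nnegrE ?mulr_ge0 ?vnorm_ge0
  ?spectral_norm_ge0 //.
rewrite exprMn Xv -Pv sqr_vnorm mulr_sumr; apply: ler_sum => i _.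
rewrite ler_wpM2r ?sqr_ge0 // lerXn2r ?nnegrE ?singular_value_ge0
  ?spectral_norm_ge0 //.
exact: le_bigmax.
Qed.

(** Each singular value is attained on a unit eigenvector of the Gram matrix, so testing the
    hypothesis there suffices. *)
Lemma spectral_norm_le X (K : R) : 0 <= K ->
  (forall v, vnorm (X *m v) <= K * vnorm v) -> spectral_norm X <= K.
Proof.
move=> K0 hK; apply: bigmax_le => // i _.
have [P [PPt Pv _ Xv]] := vnorm_mulmx_spectral X.
have := hK (P^t* *m delta_mx i 0);
  rewrite -(Pv (P^t* *m _)) (mulmxA P) PPt mul1mx.
have d1 : vnorm (delta_mx i 0 : 'cV[R[i]]_n) = 1.
  rewrite /vnorm (bigD1 i) //= big1 ?addr0 => [|j ji]; last first.
    by rewrite mxE (negbTE ji) cabs0 expr0n.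
  by rewrite mxE !eqxx cabs1 expr1n sqrtr1.
rewrite d1 mulr1; apply: le_trans.
rewrite -(ler_pXn2r (_ : 0 < 2)%N) ?nnegrE ?vnorm_ge0 ?singular_value_ge0 // Xv.
rewrite (mulmxA P) PPt mul1mx (bigD1 i) //= mxE !eqxx cabs1 expr1n mulr1 lerDl.
by apply: sumr_ge0 => j _; rewrite mulr_ge0 ?sqr_ge0.
Qed.

Lemma spectral_normD X Y : spectral_norm (X + Y) <=
  spectral_norm X + spectral_norm Y.
Proof.
apply: spectral_norm_le; first by rewrite addr_ge0 ?spectral_norm_ge0.
move=> v; rewrite mulmxDl mulrDl; apply: (le_trans (le_vnormD _ _)).
by rewrite lerD ?vnorm_mulmx_le.
Qed.

Lemma spectral_normZ (c : R[i]) X : spectral_norm (c *: X) =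
  cabs c * spectral_norm X.
Proof.
have le (a : R[i]) Y : spectral_norm (a *: Y) <= cabs a * spectral_norm Y.
  apply: spectral_norm_le => [|v].
    by rewrite mulr_ge0 ?cabs_ge0 ?spectral_norm_ge0.
  by rewrite -scalemxAl vnormZ -mulrA ler_wpM2l ?cabs_ge0 ?vnorm_mulmx_le.
apply/le_anti; rewrite le /=.
have [->|c0] := eqVneq c 0; first by rewrite cabs0 mul0r spectral_norm_ge0.
have := le c^-1 (c *: X); rewrite scalerA mulVf // scale1r cabsV.
by rewrite mulrC ler_pdivlMr ?cabs_gt0 // mulrC.
Qed.

Lemma spectral_norm_gt0 X : X != 0 -> 0 < spectral_norm X.
Proof.
move=> X0; rewrite lt_def spectral_norm_ge0 andbT; apply: contra X0 => /eqP s0.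
apply/eqP/matrixP => i j; rewrite mxE.
have := vnorm_mulmx_le X (delta_mx j 0); rewrite s0 mul0r -colE => le0.
have : vnorm (col j X) == 0 by rewrite eq_le le0 vnorm_ge0.
by rewrite vnorm_eq0 => /eqP/colP/(_ i); rewrite !mxE.
Qed.

(** A crude bound that turns entrywise continuity into local boundedness of the norm. *)
Lemma spectral_norm_le_entries X : spectral_norm X <=
  \sum_i \sum_j cabs (X i j).
Proof.
apply: spectral_norm_le => [|v].
  by apply: sumr_ge0 => i _; apply: sumr_ge0 => j _; exact: cabs_ge0.
apply: (@le_trans _ _ (\sum_i cabs ((X *m v) i 0))).
  rewrite -(ler_pXn2r (_ : 0 < 2)%N) ?nnegrE ?vnorm_ge0 ?sumr_ge0 // => [|i _].
    2: exact: cabs_ge0.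
  rewrite sqr_vnorm expr2 mulr_suml; apply: ler_sum => i _.
  rewrite expr2 ler_wpM2l ?cabs_ge0 // (bigD1 i) //= lerDl sumr_ge0 // => j _.
  exact: cabs_ge0.
rewrite mulr_suml; apply: ler_sum => i _; rewrite mxE.
apply: (le_trans (le_cabs_sum _ _ _)); rewrite mulr_suml; apply: ler_sum => j _.
by rewrite cabsM ler_wpM2l ?cabs_ge0 ?le_cabs_vnorm.
Qed.

Lemma spectral_norm_dist X Y :
  `|spectral_norm X - spectral_norm Y| <= spectral_norm (X - Y).
Proof.
have N (Z : 'M[R[i]]_n) : spectral_norm (- Z) = spectral_norm Z.
  have -> : - Z = (-1 : R[i]) *: Z by rewrite scaleN1r.
  by rewrite spectral_normZ cabsN cabs1 mul1r.
rewrite ler_distl; have := spectral_normD (X - Y) Y; have :=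
  spectral_normD (Y - X) X.
rewrite !subrK -(N (Y - X)) opprB => h1 h2; apply/andP; split; lra.
Qed.

End SpectralNorm.

(** * Leading behaviour of the amplification *)

Lemma posdefmx_unit (R : realType) (n : nat) (S : 'M[R[i]]_n) :
  posdefmx S -> S \in unitmx.
Proof.
move=> Sp; rewrite unitmxE unitfE; apply/negP => /det0P[y y0 yS].
by have := posdef_form Sp y0; rewrite yS mul0mx mxE ltxx.
Qed.

Lemma mulmx_unit_neq0 (K : fieldType) (n : nat) (S P : 'M[K]_n) :
  S \in unitmx -> P != 0 -> S *m P *m S != 0.
Proof.
move=> uS; apply: contra => /eqP SPS; apply/eqP.
by rewrite -(mulKmx uS P) -(mulmxK uS (S *m P)) SPS mul0mx mulmx0.
Qed.

Lemma amplification_asymptotics (R : realType) (n : nat) (M : 'M[R[i]]_n)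
    (A Q : Cplx R -> 'M[R[i]]_n) (l : Cplx R) (m : nat) :
  mx_holo_at Q l ->
  (\forall k \near l^', A k \in unitmx /\ invmx (A k) = (k - l) ^- m *: Q k) ->
  amplification M A =
    (fun k => spectral_norm (sqrtmx M *m Q l *m sqrtmx M) * cabs (k - l) ^- m)
    +O_ (l^') (fun k => cabs (k - l) ^ (1 - m%:Z)).
Proof.
move=> hQ iQ; set S := sqrtmx M.
have [B hB QB] := mx_holo_at_divided_difference hQ.
(* By continuity each entry of S B(k) S stays within 1 of its value at l. *)
pose C := \sum_i \sum_j (cabs ((S *m B l *m S) i j) + 1).
have hSB : mx_holo_at (fun k => S *m B k *m S) l.
  exact: (mx_holo_at_mulmx (mx_holo_at_mulmx (mx_holo_at_cst S l) hB)
    (mx_holo_at_cst S l)).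
have bC : \forall k \near l, spectral_norm (S *m B k *m S) <= C.
  have h : \forall k \near l, forall i j,
      cabs ((S *m B k *m S) i j - (S *m B l *m S) i j) < 1.
    apply: near_forall_fin => i; apply: near_forall_fin => j.
    have /derivable_cont/continuous_cabsP := holo_at_derivable (hSB i j).
    by apply; exact: ltr01.
  apply: filterS h => k h; apply: (le_trans (spectral_norm_le_entries _)).
  apply: ler_sum => i _; apply: ler_sum => j _.
  rewrite -[X in cabs X <= _](subrK ((S *m B l *m S) i j)).
  by apply: (le_trans (le_cabsD _ _)); rewrite addrC lerD2l ltW.
(* The remainder has to be bounded with every constant r > C. It comes from Q(k) - Q(l) = (k - l)
   B(k): the norms differ by at most |k - l| times that of S B(k) S. *)
apply/eqaddOP; exists C; split; first exact: num_real.
move=> r Cr.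
have h : \forall k \near l, Q k = Q l + (k - l) *: B k /\
    spectral_norm (S *m B k *m S) <= C.
  by apply: filterS2 QB bC => k.
apply: filterS3 (dnbhs_neq l) (dnbhs_near h) iQ => k kl [QE leC] [_ ik].
have h0 : 0 < cabs (k - l) by rewrite cabs_gt0.
have -> : (amplification M A -
  (fun k => spectral_norm (S *m Q l *m S) * cabs (k - l) ^- m)) k
    = (spectral_norm (S *m Q k *m S) - spectral_norm (S *m Q l *m S)) *
      cabs (k - l) ^- m.
  rewrite [LHS]/(_ - _) /amplification ik -/S -scalemxAr -scalemxAl
    spectral_normZ.
  by rewrite cabsV cabsX mulrBl mulrC.
have -> : cabs (k - l) ^ (1 - m%:Z) = cabs (k - l) * cabs (k - l) ^- m.
  by rewrite expfzDr ?gt_eqF // expr1z exprnN.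
rewrite !normrM mulrA ler_wpM2r ?normr_ge0 // (gtr0_norm h0).
apply: (le_trans (spectral_norm_dist _ _)).
have -> : S *m Q k *m S - S *m Q l *m S = (k - l) *: (S *m B k *m S).
  by rewrite QE mulmxDr mulmxDl addrAC subrr add0r -scalemxAr -scalemxAl.
rewrite spectral_normZ mulrC ler_wpM2r ?cabs_ge0 //.
by apply: (le_trans leC); exact: ltW.
Qed.

Theorem proposition3p4 (R : realType) (Nh : nat) :
  exists psi : 'M[R[i]]_(Nh + Nh) -> 'M[R[i]]_(Nh + Nh) -> R,
  forall (M : 'M[R[i]]_(Nh + Nh)) (D : set (Cplx R))
    (A : Cplx R -> 'M[R[i]]_(Nh + Nh)) (lambda : Cplx R),
  posdefmx M ->
  open D -> connected D ->
  mx_holomorphic D A ->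
  (exists k, D k /\ A k \in unitmx) ->
  D lambda -> A lambda \notin unitmx ->
  exists m : nat,
    [/\ (1 <= m)%N, longest_chain A lambda m &
     exists P : nat -> 'M[R[i]]_(Nh + Nh),
       [/\ inverse_expansion A lambda m P, P m != 0, 0 < psi M (P m) &
        amplification M A
          = (fun k => psi M (P m) * cabs (k - lambda) ^- m)
            +O_ (lambda^') (fun k => cabs (k - lambda) ^ (1 - m%:Z))]].
Proof.
(* Chosen before A, D and lambda: this is how dependence on M and the leading coefficient alone is
   expressed. It is positive because the square root of M is invertible and the leading coefficient
   is nonzero. *)
exists (fun M P => spectral_norm (sqrtmx M *m P *m sqrtmx M)).
move=> M D A l Mp oD cD hA uA Dl nu.
have [m [Q [m0 hQ Ql iQ]]] := invmx_pole oD cD hA uA Dl nu.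
have [P PE Pm] := inverse_expansion_pole m0 hQ iQ.
have hAl : mx_holo_at A l.
  by move=> i j; apply: (holo_at_open oD Dl) => k Dk; exact: hA.
have lc := longest_chain_pole hAl m0 hQ Ql iQ.
exists m; split; [exact: m0|exact: lc|].
exists P; split; rewrite ?Pm; [exact: PE|exact: Ql| |].
- apply/spectral_norm_gt0/mulmx_unit_neq0 => //; apply: posdefmx_unit.
  by have [] := sqrtmxP Mp.
- exact: amplification_asymptotics.
Qed.
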